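(* There is a positive equivalence relation $\vartheta$ satisfying: (1) there is only one $\vartheta$-infinite r.e. set, namely $\mathbb{N}$; (2) every $\vartheta$-family contains an infinite ascending chain $B_0\subset B_1\subset\cdots$ of $\vartheta$-finite sets whose union is $\mathbb{N}$; in particular, no $\vartheta$-family is confidently learnable, and every behaviourally correctly learnable $\vartheta$-family consists only of $\vartheta$-finite sets; (3) every vacillatorily learnable $\vartheta$-family is explanatorily learnable.
   Context: A positive equivalence relation is an equivalence relation $\eta$ on $\mathbb{N}$ that is recursively enumerable (as a set of pairs) and has infinitely many equivalence classes. A set is $\eta$-closed if it is a union of $\eta$-classes, $\eta$-finite if it is a union of finitely many $\eta$-classes, and $\eta$-infinite if it is a union of infinitely many $\eta$-classes. An $\eta$-family is an infinite family of $\eta$-closed sets possessing a uniformly r.e. one-one numbering $B_0,B_1,\dots$ (i.e. $\{\langle k,x\rangle:x\in B_k\}$ is r.e. and $B_i\neq B_j$ for $i\ne j$). $W_0,W_1,\dots$ is a fixed acceptable numbering of the r.e. sets. A text for $L$ is a total $T:\mathbb N\to\mathbb N\cup\{\#\}$ whose range minus $\{\#\}$ is $L$; $T[n]$ is its initial segment of length $n$. A learner is a recursive function $M$ from finite sequences over $\mathbb N\cup\{\#\}$ to $\mathbb N\cup\{?\}$; an output $e$ is interpreted as the hypothesis ''the $\eta$-closure of $W_e$''. A family $\mathcal C$ is explanatorily learnable if some $M$, on every text $T$ for every $L\in\mathcal C$, outputs from some point on a single index whose hypothesis equals $L$; behaviourally correctly learnable if some $M$, on every such text, outputs for almost all $n$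 an index whose hypothesis equals $L$; vacillatorily learnable if some $M$ behaviourally correctly learns $\mathcal C$ and on every text $T$ for every $L\in\mathcal C$ the set $\{M(T[n]):n\ge1\}$ is finite; confidently learnable if some $M$ explanatorily learns $\mathcal C$ and on every text for every set $L\subseteq\mathbb N$ the sequence $M(T[n])$ converges. *)

(* Defs.v *)
From mathcomp Require Import all_boot.
From mathcomp Require Import boolp classical_sets functions cardinality.
Set Implicit Arguments.
Unset Strict Implicit.
Unset Printing Implicit Defensive.
Local Open Scope classical_set_scope.
Local Open Scope nat_scope.

(* Kleene's partial recursive functions: [recf n] is the type of programs for
   n-ary functions, and [computes f v y] says that f is defined at v with
   value y.  The recursion variable of [Prec] and the search variable of [Mu]
   come first in the argument tuple. *)
Inductive recf : nat -> Type :=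
| Zero : recf 0
| Succ : recf 1
| Proj n (i : 'I_n) : recf n
| Comp m n (f : recf m) (g : 'I_m -> recf n) : recf n
| Prec n (f : recf n) (g : recf n.+2) : recf n.+1
| Mu n (f : recf n.+1) : recf n.

Fixpoint computes n (f : recf n) : n.-tuple nat -> nat -> Prop :=
  match f in recf n return n.-tuple nat -> nat -> Prop with
  | Zero => fun _ y => y = 0
  | Succ => fun v y => y = (thead v).+1
  | Proj _ i => fun v y => y = tnth v i
  | Comp m _ f g => fun v y =>
      exists w : m.-tuple nat,
        (forall i, computes (g i) v (tnth w i)) /\ computes f w y
  | Prec n f g => fun v y =>
      (* s is the sequence of values at recursion arguments 0, 1, 2, ... *)
      exists s : nat -> nat,
        [/\ computes f (behead_tuple v) (s 0),
            forall i, i < thead v ->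
              computes g (cons_tuple i (cons_tuple (s i) (behead_tuple v)))
                (s i.+1)
          & y = s (thead v)]
  | Mu n f => fun v y =>
      computes f (cons_tuple y v) 0 /\
      forall z, z < y -> exists t, computes f (cons_tuple z v) t.+1
  end.

Definition recursive (h : nat -> nat) : Prop :=
  exists f : recf 1, forall x, computes f [tuple x] (h x).

Definition re (A : set nat) : Prop :=
  exists f : recf 1, forall x, A x <-> exists y, computes f [tuple x] y.

(* Sets of pairs are kept curried: a numbering B : nat -> set nat is uniformly
   r.e. iff [re2 B], and a binary relation R is r.e. iff [re2 R]. *)
Definition re2 (R : nat -> set nat) : Prop :=
  exists f : recf 2, forall k x, R k x <-> exists y, computes f [tuple k; x] y.

Definition acceptable_numbering (W : nat -> set nat) : Prop :=
  [/\ re2 W,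
      forall A, re A -> exists e, W e = A
    & forall V : nat -> set nat, re2 V ->
        exists h, recursive h /\ forall k, W (h k) = V k].

(* For an equivalence relation [eta : nat -> set nat], the class of x is the
   set [eta x]. *)
Definition classes (eta : nat -> set nat) : set (set nat) := range eta.

Definition positive_equivalence (eta : nat -> set nat) : Prop :=
  [/\ RelationClasses.Equivalence eta,
      re2 eta
    & infinite_set (classes eta)].

Definition eta_closed (eta : nat -> set nat) (A : set nat) : Prop :=
  exists F : set (set nat), F `<=` classes eta /\ A = \bigcup_(C in F) C.

Definition eta_finite (eta : nat -> set nat) (A : set nat) : Prop :=
  exists F : set (set nat),
    [/\ F `<=` classes eta, finite_set F & A = \bigcup_(C in F) C].

Definition eta_infinite (eta : nat -> set nat) (A : set nat) : Prop :=
  exists F : set (set nat),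
    [/\ F `<=` classes eta, infinite_set F & A = \bigcup_(C in F) C].

Definition eta_closure (eta : nat -> set nat) (A : set nat) : set nat :=
  \bigcup_(x in A) eta x.

Definition eta_family (eta : nat -> set nat) (C : set (set nat)) : Prop :=
  [/\ infinite_set C,
      forall L, C L -> eta_closed eta L
    & exists B : nat -> set nat, [/\ range B = C, injective B & re2 B]].

(* In texts [None] is the pause symbol #; as a learner's output it is ?. *)
Definition text := nat -> option nat.

Definition text_for (T : text) (L : set nat) : Prop :=
  [set x | exists n, T n = Some x] = L.

Definition init_seg (T : text) (n : nat) : seq (option nat) := mkseq T n.

Definition learner := seq (option nat) -> option nat.

Definition code_opt (o : option nat) : nat := if o is Some x then x.+1 else 0.

Definition code_seq (s : seq (option nat)) : nat :=
  CodeSeq.code (map code_opt s).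

Definition recursive_learner (M : learner) : Prop :=
  exists f : recf 1, forall s, computes f [tuple code_seq s] (code_opt (M s)).

Definition correct (eta W : nat -> set nat) (o : option nat) (L : set nat)
    : Prop :=
  exists e, o = Some e /\ eta_closure eta (W e) = L.

Definition ex_learns (eta W : nat -> set nat) (M : learner)
    (C : set (set nat)) : Prop :=
  forall L T, C L -> text_for T L ->
    exists o, correct eta W o L /\
      exists n0, forall n, n0 <= n -> M (init_seg T n) = o.

Definition bc_learns (eta W : nat -> set nat) (M : learner)
    (C : set (set nat)) : Prop :=
  forall L T, C L -> text_for T L ->
    exists n0, forall n, n0 <= n -> correct eta W (M (init_seg T n)) L.

Definition ex_learnable (eta W : nat -> set nat) (C : set (set nat)) : Prop :=
  exists M, recursive_learner M /\ ex_learns eta W M C.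

Definition bc_learnable (eta W : nat -> set nat) (C : set (set nat)) : Prop :=
  exists M, recursive_learner M /\ bc_learns eta W M C.

Definition vac_learnable (eta W : nat -> set nat) (C : set (set nat)) : Prop :=
  exists M, [/\ recursive_learner M, bc_learns eta W M C
    & forall L T, C L -> text_for T L ->
        finite_set [set M (init_seg T n) | n in [set n | 1 <= n]]].

(* Off the family, convergence is meant in N + {?}, so the limit may be ?. *)
Definition confidently_learnable (eta W : nat -> set nat)
    (C : set (set nat)) : Prop :=
  exists M, [/\ recursive_learner M, ex_learns eta W M C
    & forall L T, text_for T L ->
        exists o n0, forall n, n0 <= n -> M (init_seg T n) = o].

(* Main.v *)
(* Write a_0 < a_1 < ... for the least elements of the classes and W_e,s for
   the elements of W_e found by stage s. At stage s, if the class of a_l meets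
   W_e,s while the class of a_k does not, for some k < l and e < l, merge the
   former into the latter, the least such a_l first. A pair (e, k) acts at most
   once on a settled a_k and moves only a_l with l > max(e, k), so every marker
   settles and there are infinitely many classes. If a final a_l with l > e is
   met by W_e, then so is every a_k with k < l; hence an r.e. closed set is a
   union of finitely many classes or N, and this dichotomy alone yields the
   chain in any family and, by running through the chain, a text for N on which
   a learner keeps changing its mind.

   If the closure of W_e is not N, the set of markers it contains can be
   computed in the limit: a stable marker outside W_e prevents markers above it
   of index > e from entering, and below it only finitely many stable facts
   matter. A learner that outputs only finitely many correct indices in the end
   is made convergent by replacing each index with an index for the current
   guess of this finite set, which in the limit depends only on the language. *)
Require Import Defs.
From mathcomp Require Import all_boot.
From mathcomp Require Import boolp classical_sets functions cardinality.
Set Implicit Arguments.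
Unset Strict Implicit.
Unset Printing Implicit Defensive.
Local Open Scope classical_set_scope.
Local Open Scope nat_scope.

(** * Computable functions *)

Definition scons (x : nat) (v : nat -> nat) : nat -> nat :=
  fun i => if i is j.+1 then v j else x.

(** Environments are total functions, of which [args n] keeps the first [n] values; this avoids
    casts between tuple types of different lengths. *)
Definition args n (v : nat -> nat) : n.-tuple nat := mktuple (fun i : 'I_n => v i).

Definition computable n (h : (nat -> nat) -> nat) : Prop :=
  exists f : recf n, forall v, computes f (args n v) (h v).

Lemma thead_args n v : thead (args n.+1 v) = v 0.
Proof. by rewrite /thead tnth_mktuple. Qed.

Lemma behead_args n v : behead_tuple (args n.+1 v) = args n (fun i => v i.+1).
Proof.
apply: eq_from_tnth => i; rewrite tnth_mktuple tnth_behead tnth_mktuple /=.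
by rewrite inordK // ltnS.
Qed.

Lemma cons_args n x v : cons_tuple x (args n v) = args n.+1 (scons x v).
Proof.
apply: eq_from_tnth => i; rewrite tnth_mktuple.
case: (unliftP ord0 i) => [j ->|->]; first by rewrite tnthS tnth_mktuple.
by rewrite tnth0.
Qed.

Lemma args_nth n (w : n.-tuple nat) : args n (nth 0 w) = w.
Proof. by apply: eq_from_tnth => i; rewrite tnth_mktuple (tnth_nth 0). Qed.

Lemma args1 v : args 1 v = [tuple v 0].
Proof. by apply: val_inj; rewrite /= enum_ordSl enum_ord0. Qed.

Lemma args2 v : args 2 v = [tuple v 0; v 1].
Proof. by apply: val_inj; rewrite /= enum_ordSl enum_ordSl enum_ord0. Qed.

Lemma computes_fun n (f : recf n) v y z : computes f v y -> computes f v z -> y = z.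
Proof.
elim: n / f v y z => [| |n i|m n f IHf g IHg|n f IHf g IHg|n f IHf] v y z /=.
- by move=> -> ->.
- by move=> -> ->.
- by move=> -> ->.
- move=> [w [gw fw]] [w' [gw' fw']].
  suff eq_w : w = w' by rewrite eq_w in fw; exact: IHf fw fw'.
  by apply: eq_from_tnth => i; apply: IHg (gw i) (gw' i).
- move=> [s [f0 gs ->]] [t [g0 gt ->]].
  have : forall k, k <= thead v -> s k = t k.
    elim=> [|k IHk] lek; first exact: IHf f0 g0.
    apply: IHg (gs _ lek) _; rewrite IHk ?(ltnW lek) //; exact: gt.
  exact.
(* The smaller of two distinct results would be both a zero of [f] and a place where [f] is
   positive. *)
- move=> [fy lty] [fz ltz]; apply/eqP; case: ltngtP => // lt.
    by have [t ft] := ltz _ lt; have := IHf _ _ _ fy ft.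
  by have [t ft] := lty _ lt; have := IHf _ _ _ fz ft.
Qed.

(* Composition keeps the whole environment function; [m] only says how many
   of the [g i] have to be computable. *)
Lemma computable_comp m n h (g : nat -> (nat -> nat) -> nat) :
  computable m h -> (forall i, i < m -> computable n (g i)) ->
  computable n (fun v => h (fun i => g i v)).
Proof.
move=> [f fP] gP; have [G GP] := choice (fun i : 'I_m => gP i (ltn_ord i)).
exists (Comp f G) => v /=; exists (args m (fun i => g i v)); split=> // i.
by rewrite tnth_mktuple.
Qed.

Lemma computable_var n i : i < n -> computable n (fun v => v i).
Proof. by move=> ltin; exists (Proj (Ordinal ltin)) => v /=; rewrite tnth_mktuple. Qed.

Lemma computable_succ n a : computable n a -> computable n (fun v => (a v).+1).
Proof.
move=> Ha; apply: (@computable_comp 1 n (fun w => (w 0).+1) (fun=> a)) => //.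
by exists Succ => v; rewrite /= thead_args.
Qed.

Lemma computable_const n c : computable n (fun=> c).
Proof.
elim: c => [|c IHc]; last exact: computable_succ.
apply: (@computable_comp 0 n (fun=> 0) (fun=> fun=> 0)) => //.
by exists Zero.
Qed.

(** [Prec] covers the case where the bound is variable 0; composition then substitutes [k]. In the
    hypothesis on [b], variable 0 is the counter and variable 1 the previous value. *)
Lemma computable_rec n k a b :
  computable n k -> computable n a ->
  computable n.+2 (fun w => b (w 0) (w 1) (fun i => w i.+2)) ->
  computable n (fun v => nat_rect (fun=> nat) (a v) (fun i z => b i z v) (k v)).
Proof.
move=> Hk [fa Ha] [fb Hb].
have H : computable n.+1 (fun w => nat_rect (fun=> nat) (a (fun i => w i.+1))
   (fun i z => b i z (fun i => w i.+1)) (w 0)).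
  exists (Prec fa fb) => v /=; rewrite thead_args behead_args.
  exists (nat_rect (fun=> nat) (a (fun i => v i.+1))
           (fun i z => b i z (fun i => v i.+1))); split=> // i _ /=.
  by rewrite !cons_args; apply: Hb.
apply: (@computable_comp n.+1 n _
  (fun i => if i is j.+1 then fun v => v j else k) H) => -[|i] //.
by rewrite ltnS; exact: computable_var.
Qed.

Lemma computable_app1 n F a : computable 1 (fun v => F (v 0)) ->
  computable n a -> computable n (fun v => F (a v)).
Proof. by move=> HF Ha; apply: (@computable_comp 1 n _ (fun=> a) HF). Qed.

Lemma computable_app2 n F a b : computable 2 (fun v => F (v 0) (v 1)) ->
  computable n a -> computable n b -> computable n (fun v => F (a v) (b v)).
Proof.
move=> HF Ha Hb.
by apply: (@computable_comp 2 n _ (fun i => if i is 0 then a else b) HF) => -[].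
Qed.

Lemma computable_app3 n F a b c : computable 3 (fun v => F (v 0) (v 1) (v 2)) ->
  computable n a -> computable n b -> computable n c ->
  computable n (fun v => F (a v) (b v) (c v)).
Proof.
move=> HF Ha Hb Hc.
by apply: (@computable_comp 3 n _ (fun i =>
  match i with 0 => a | 1 => b | _ => c end) HF) => -[|[]].
Qed.

Lemma eq_computable n h h' : h =1 h' -> computable n h -> computable n h'.
Proof. by move=> eq_h; rewrite (_ : h' = h) //; apply/funext => v; rewrite eq_h. Qed.

Lemma computable_add n a b : computable n a -> computable n b ->
  computable n (fun v => a v + b v).
Proof.
move=> Ha Hb; apply: (@eq_computable _ (fun v =>
  nat_rect (fun=> nat) (b v) (fun i z => z.+1) (a v))).
  by move=> v; elim: (a v) => //= k ->; rewrite addSn.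
apply: (@computable_rec n a b (fun i z v => z.+1)) => //.
exact/computable_succ/computable_var.
Qed.

Lemma computable_pred n a : computable n a -> computable n (fun v => (a v).-1).
Proof.
move=> Ha; apply: (@eq_computable _ (fun v =>
  nat_rect (fun=> nat) 0 (fun i z => i) (a v))); first by move=> v; case: (a v).
apply: (@computable_rec n a _ (fun i z v => i)) => //.
  exact: computable_const.
exact/computable_var.
Qed.

Lemma computable_sub n a b : computable n a -> computable n b ->
  computable n (fun v => a v - b v).
Proof.
move=> Ha Hb; apply: (@eq_computable _ (fun v =>
  nat_rect (fun=> nat) (a v) (fun i z => z.-1) (b v))).
  by move=> v; elim: (b v) => [|k IHk] /=; rewrite ?subn0 // IHk subnS.
apply: (@computable_rec n b a (fun i z v => z.-1)) => //.
exact/computable_pred/computable_var.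
Qed.

Lemma computable_mul n a b : computable n a -> computable n b ->
  computable n (fun v => a v * b v).
Proof.
move=> Ha Hb; apply: (@eq_computable _ (fun v =>
  nat_rect (fun=> nat) 0 (fun i z => b v + z) (a v))).
  by move=> v; elim: (a v) => //= k ->; rewrite mulSn.
apply: (@computable_rec n a _ (fun i z v => b v + z)) => //.
  exact: computable_const.
apply: computable_add; last exact/computable_var.
apply: (@computable_comp n n.+2 b (fun i v => v i.+2)) => // i lti.
exact: computable_var.
Qed.

Lemma computable_exp n a b : computable n a -> computable n b ->
  computable n (fun v => a v ^ b v).
Proof.
move=> Ha Hb; apply: (@eq_computable _ (fun v =>
  nat_rect (fun=> nat) 1 (fun i z => a v * z) (b v))).
  by move=> v; elim: (b v) => //= k ->; rewrite expnS.
apply: (@computable_rec n b _ (fun i z v => a v * z)) => //.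
  exact: computable_const.
apply: computable_mul; last exact/computable_var.
apply: (@computable_comp n n.+2 a (fun i v => v i.+2)) => // i lti.
exact: computable_var.
Qed.

Lemma computable_eq0 n a : computable n a -> computable n (fun v => a v == 0).
Proof.
move=> Ha; apply: (@eq_computable _ (fun v => 1 - a v)).
  by move=> v; case: (a v) => [|[]].
by apply: computable_sub => //; exact: computable_const.
Qed.

Lemma computable_leq n a b : computable n a -> computable n b ->
  computable n (fun v => a v <= b v).
Proof.
by move=> Ha Hb; apply: computable_eq0; apply: computable_sub.
Qed.

Lemma computable_ltn n a b : computable n a -> computable n b ->
  computable n (fun v => a v < b v).
Proof. by move=> Ha Hb; apply: computable_leq => //; exact: computable_succ. Qed.

Lemma computable_and n (a b : (nat -> nat) -> bool) :
  computable n a -> computable n b -> computable n (fun v => a v && b v).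
Proof.
move=> Ha Hb; apply: (@eq_computable _ (fun v => a v * b v)).
  by move=> v; rewrite mulnb.
exact: computable_mul.
Qed.

Lemma computable_not n (a : (nat -> nat) -> bool) :
  computable n a -> computable n (fun v => ~~ a v).
Proof.
move=> Ha; apply: (@eq_computable _ (fun v => (a v : nat) == 0)).
  by move=> v; case: (a v).
exact: computable_eq0.
Qed.

Lemma computable_or n (a b : (nat -> nat) -> bool) :
  computable n a -> computable n b -> computable n (fun v => a v || b v).
Proof.
move=> Ha Hb; apply: (@eq_computable _ (fun v => ~~ (~~ a v && ~~ b v))).
  by move=> v; rewrite negb_and !negbK.
by apply/computable_not/computable_and; apply: computable_not.
Qed.

Lemma computable_imp n (a b : (nat -> nat) -> bool) :
  computable n a -> computable n b -> computable n (fun v => a v ==> b v).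
Proof.
move=> Ha Hb; apply: (@eq_computable _ (fun v => ~~ a v || b v)).
  by move=> v; rewrite implybE.
by apply/computable_or => //; apply: computable_not.
Qed.

Lemma computable_eq n a b : computable n a -> computable n b ->
  computable n (fun v => a v == b v).
Proof.
move=> Ha Hb; apply: (@eq_computable _ (fun v => (a v <= b v) && (b v <= a v))).
  by move=> v; rewrite eqn_leq.
by apply: computable_and; apply: computable_leq.
Qed.

Lemma computable_if n (p : (nat -> nat) -> bool) a b :
  computable n p -> computable n a -> computable n b ->
  computable n (fun v => if p v then a v else b v).
Proof.
move=> Hp Ha Hb; apply: (@eq_computable _ (fun v => p v * a v + ~~ p v * b v)).
  by move=> v; case: (p v); rewrite ?mul1n ?mul0n ?addn0.
by apply: computable_add; apply: computable_mul => //; apply: computable_not.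
Qed.

(** * Bounded sums, quantifiers and search *)

(** Quantifiers and search reduce to sums of truth values 0 and 1, so that only [bsum] needs a
    recursion. *)
Definition bsum k (F : nat -> nat) : nat := \sum_(i < k) F i.
Definition bex k (p : nat -> bool) : bool := 0 < bsum k p.
Definition ball k (p : nat -> bool) : bool := ~~ bex k (fun i => ~~ p i).
(* The least [i < k] with [p i], and [k] if there is none. *)
Definition bmin k (p : nat -> bool) : nat :=
  bsum k (fun i => ball i.+1 (fun j => ~~ p j)).

Lemma bsumS k F : bsum k.+1 F = bsum k F + F k.
Proof. by rewrite /bsum big_ord_recr. Qed.

Lemma bsum0 F : bsum 0 F = 0.
Proof. by rewrite /bsum big_ord0. Qed.

Lemma bexP k (p : nat -> bool) : reflect (exists2 i, i < k & p i) (bex k p).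
Proof.
apply: (iffP idP); rewrite /bex.
  elim: k => [|k IHk]; first by rewrite bsum0.
  rewrite bsumS addn_gt0 => /orP[/IHk[i lti pi]|]; first by exists i => //; exact: ltnW.
  by case pk: (p k) => // _; exists k.
move=> [i lti pi]; rewrite /bsum (bigD1 (Ordinal lti)) //= pi; exact: ltn_addr.
Qed.

Lemma ballP k (p : nat -> bool) : reflect (forall i, i < k -> p i) (ball k p).
Proof.
apply: (iffP negP) => [H i lti|H /bexP[i lti]]; last by rewrite H.
by apply: contrapT => /negP npi; apply: H; apply/bexP; exists i.
Qed.

Lemma bminP k p : [/\ bmin k p <= k, forall i, i < bmin k p -> ~~ p i &
  bmin k p < k -> p (bmin k p)].
Proof.
elim: k => [|k [le lt eq]]; first by rewrite /bmin bsum0.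
(* The new summand is 1 exactly when no [j <= k] satisfies [p]. *)
have -> : bmin k.+1 p = bmin k p + ball k.+1 (fun j => ~~ p j) by rewrite /bmin bsumS.
case: (ballP k.+1) => [H|H]; rewrite ?addn1 ?addn0.
  have Ek : bmin k p = k.
    apply/eqP; rewrite eqn_leq le leqNgt; apply/negP => lk.
    by have := H _ (ltnW lk); rewrite eq.
  by rewrite Ek; split=> //; rewrite ltnn.
split=> //; first exact: leqW.
rewrite ltnS leq_eqVlt => /orP[/eqP Ek|/eq//].
apply: contrapT => /negP; rewrite Ek => npk; apply: H => i; rewrite ltnS leq_eqVlt.
by move=> /orP[/eqP-> //|]; rewrite -{1}Ek => /lt.
Qed.

Lemma computable_bsum n k b : computable n k ->
  computable n.+1 (fun w => b (w 0) (fun i => w i.+1)) ->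
  computable n (fun v => bsum (k v) (fun i => b i v)).
Proof.
move=> Hk Hb; apply: (@eq_computable _ (fun v =>
  nat_rect (fun=> nat) 0 (fun i z => z + b i v) (k v))).
  by move=> v; elim: (k v) => [|j IHj] /=; rewrite ?bsum0 // IHj bsumS.
apply: (@computable_rec n k _ (fun i z v => z + b i v)) => //.
  exact: computable_const.
apply: computable_add; first exact/computable_var.
(* The accumulator in position 1 is skipped: [b] sees only the counter and the environment. *)
apply: (@computable_comp n.+1 n.+2 _
  (fun i v => if i is 0 then v 0 else v i.+1) Hb) => -[_|i lti];
exact: computable_var.
Qed.

Lemma computable_bex n k (b : nat -> (nat -> nat) -> bool) : computable n k ->
  computable n.+1 (fun w => b (w 0) (fun i => w i.+1)) ->
  computable n (fun v => bex (k v) (fun i => b i v)).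
Proof.
move=> Hk Hb; apply: computable_ltn; first exact: computable_const.
exact: (@computable_bsum n k (fun i v => b i v)).
Qed.

Lemma computable_ball n k (b : nat -> (nat -> nat) -> bool) : computable n k ->
  computable n.+1 (fun w => b (w 0) (fun i => w i.+1)) ->
  computable n (fun v => ball (k v) (fun i => b i v)).
Proof.
move=> Hk Hb; apply: computable_not.
by apply: (@computable_bex n k (fun i v => ~~ b i v)) => //; apply: computable_not.
Qed.

Lemma computable_bmin n k (b : nat -> (nat -> nat) -> bool) : computable n k ->
  computable n.+1 (fun w => b (w 0) (fun i => w i.+1)) ->
  computable n (fun v => bmin (k v) (fun i => b i v)).
Proof.
move=> Hk Hb.
apply: (@computable_bsum n k (fun i v => ball i.+1 (fun j => ~~ b j v))) => //.
apply: (@computable_ball n.+1 (fun w => (w 0).+1)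
  (fun j w => ~~ b j (fun i => w i.+1))); first exact/computable_succ/computable_var.
apply: computable_not.
apply: (@computable_comp n.+1 n.+2 (fun w => b (w 0) (fun i => w i.+1))
  (fun i v => if i is 0 then v 0 else v i.+1) Hb) => -[_|i lti];
exact: computable_var.
Qed.

(** The quotient counts the [k < a] with [k.+1 * b <= a]; the test [0 < b] matches the convention
    that division by 0 gives 0. *)
Lemma computable_divn n a b : computable n a -> computable n b ->
  computable n (fun v => a v %/ b v).
Proof.
move=> Ha Hb; apply: (@eq_computable _ (fun v =>
  bsum (a v) (fun k => (0 < b v) && (k.+1 * b v <= a v)))).
  move=> v; case: (posnP (b v)) => [->|b0].
    by rewrite divn0 /bsum /= big1.
  transitivity (bsum (a v) (fun k => k < a v %/ b v)).
    by rewrite /bsum; apply: eq_bigr => i _; rewrite /= leq_divRL.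
  have : a v %/ b v <= a v by exact: leq_div.
  elim: (a v) (a v %/ b v) => [|x IHx] y; first by rewrite leqn0 bsum0 => /eqP.
  rewrite leq_eqVlt bsumS => /orP[/eqP->|].
    rewrite ltnSn addn1 -[in RHS](IHx x (leqnn x)) /bsum; congr _.+1.
    by apply: eq_bigr => i _; rewrite ltn_ord ltnS ltnW.
  by rewrite ltnS => leyx; rewrite IHx // ltnNge leyx addn0.
apply: (@computable_bsum n a (fun k v => (0 < b v) && (k.+1 * b v <= a v))) => //.
have wk c : computable n c -> computable n.+1 (fun w => c (fun i => w i.+1)).
  move=> Hc; apply: (@computable_comp n n.+1 c (fun i v => v i.+1)) => // i lti.
  exact: computable_var.
apply: computable_and.
  by apply: computable_ltn; [exact: computable_const | exact: wk].
apply: computable_leq; last exact: wk.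
by apply: computable_mul; [exact/computable_succ/computable_var | exact: wk].
Qed.

Lemma computable_modn n a b : computable n a -> computable n b ->
  computable n (fun v => a v %% b v).
Proof.
move=> Ha Hb; apply: (@eq_computable _ (fun v => a v - a v %/ b v * b v)).
  by move=> v; rewrite {1}(divn_eq (a v) (b v)) addKn.
apply: computable_sub => //; apply: computable_mul => //; exact: computable_divn.
Qed.

Lemma computable_odd n a : computable n a -> computable n (fun v => odd (a v)).
Proof.
move=> Ha; apply: (@eq_computable _ (fun v => a v %% 2)); first by move=> v; rewrite modn2.
by apply: computable_modn => //; exact: computable_const.
Qed.

Ltac rec_step := lazymatch goal with
 | |- computable _ (fun v => v ?i) => apply: computable_var
 | |- computable _ (fun _ => ?c) => exact: computable_const
 | |- computable _ (fun v => (@?a v).+1) => apply: computable_succ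
 | |- computable _ (fun v => (@?a v).-1) => apply: computable_pred
 | |- computable _ (fun v => @?a v + @?b v) => apply: computable_add
 | |- computable _ (fun v => @?a v - @?b v) => apply: computable_sub
 | |- computable _ (fun v => @?a v * @?b v) => apply: computable_mul
 | |- computable _ (fun v => @?a v ^ @?b v) => apply: computable_exp
 | |- computable _ (fun v => @?a v %/ @?b v) => apply: computable_divn
 | |- computable _ (fun v => @?a v %% @?b v) => apply: computable_modn
 | |- computable _ (fun v => nat_of_bool (@?a v && @?b v)) => apply: computable_and
 | |- computable _ (fun v => nat_of_bool (@?a v || @?b v)) => apply: computable_or
 | |- computable _ (fun v => nat_of_bool (@?a v ==> @?b v)) => apply: computable_imp
 | |- computable _ (fun v => nat_of_bool (~~ @?a v)) => apply: computable_not
 | |- computable _ (fun v => nat_of_bool (@?a v == @?b v)) => apply: computable_eq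
 | |- computable _ (fun v => nat_of_bool (@?a v <= @?b v)) => apply: computable_leq
 | |- computable _ (fun v => nat_of_bool (odd (@?a v))) => apply: computable_odd
 | |- computable _ (fun v => bsum (@?k v) (@?b v)) => apply: computable_bsum
 | |- computable _ (fun v => nat_of_bool (bex (@?k v) (@?b v))) =>
     apply: computable_bex
 | |- computable _ (fun v => nat_of_bool (ball (@?k v) (@?b v))) =>
     apply: computable_ball
 | |- computable _ (fun v => bmin (@?k v) (@?b v)) => apply: computable_bmin
 | |- computable _ (fun v => nat_rect _ (@?a v) (@?b v) (@?k v)) =>
     apply: computable_rec
 (* An unknown predicate is left to the caller, even if a conditional occurs inside it. *)
 | |- computable _ (fun v => nat_of_bool (@?p v)) => fail
 | |- context [if _ then _ else _] => apply: computable_if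
 end.
Ltac rec_tac := repeat first [done | rec_step].

(** * Step-bounded evaluation of programs *)

(** Finitely many thresholds have a maximum; the limit arguments below rest on this. *)
Lemma eventually_forall_lt n (P : nat -> nat -> Prop) :
  (forall i, i < n -> exists s, forall t, s <= t -> P i t) ->
  exists s, forall i t, i < n -> s <= t -> P i t.
Proof.
elim: n => [|n IHn] H; first by exists 0.
have [s Ps] : exists s, forall i t, i < n -> s <= t -> P i t.
  by apply: IHn => i lti; apply: H; exact: ltnW.
have [u Pu] := H n (leqnn _).
exists (maxn s u) => i t; rewrite ltnS leq_eqVlt geq_max => /orP[/eqP->|lti] /andP[st ut].
  exact: Pu.
exact: Ps.
Qed.

(* Evaluation of a program with [s] units of search effort: [0] means that no
   value has been found yet, and [y.+1] that the value is [y]. *)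
Lemma step_evaluator n (f : recf n) : exists E : nat -> (nat -> nat) -> nat,
  [/\ computable n.+1 (fun w => E (w 0) (fun i => w i.+1)),
      forall v u s t y, (forall i, i < n -> v i = u i) -> s <= t ->
        E s v = y.+1 -> E t u = y.+1
    & forall v y, computes f (args n v) y <-> exists s, E s v = y.+1].
Proof.
elim: n / f => [| |n i|m n f [F [cF mF hF]] g IHg|n f [F [cF mF hF]] g [G [cG mG hG]]
  |n f [F [cF mF hF]]].
- exists (fun _ _ => 1); split=> [|//|v y /=]; first exact: computable_const.
  by split=> [->|[_ [<-]]]//; exists 0.
- exists (fun _ v => (v 0).+2); split=> [|v u s t y vu|v y /=]; first by rec_tac.
    by rewrite vu.
  by rewrite thead_args; split=> [->|[_ [<-]]]//; exists 0.
- exists (fun _ v => (v i).+1); split=> [|v u s t y vu|v y /=].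
  + by apply/computable_succ/computable_var; rewrite ltnS.
  + by rewrite vu.
  by rewrite tnth_mktuple; split=> [->|[_ [<-]]]//; exists 0.
- have [G0 G0P] := choice IHg.
  (* A dummy evaluator outside ['I_m] gives a family indexed by [nat], as [computable_comp]
     expects. *)
  pose G j := if insub j is Some i then G0 i else fun _ _ => 1.
  have GE (i : 'I_m) : G i = G0 i by rewrite /G valK.
  have GP j : j < m -> [/\ computable n.+1 (fun w => G j (w 0) (fun i => w i.+1)) &
      forall v u s t y, (forall i, i < n -> v i = u i) -> s <= t ->
        G j s v = y.+1 -> G j t u = y.+1].
    by move=> ltj; rewrite (GE (Ordinal ltj)); have [] := G0P (Ordinal ltj).
  (* The product stays 0 until all arguments of [F] have been evaluated. *)
  exists (fun s v => (ball m (fun j => 0 < G j s v)) * F s (fun j => (G j s v).-1)).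
  split.
  + apply: computable_mul.
      (* The [G j] are separate programs, not one program with parameter [j], so this conjunction is
         built by induction on [m]. *)
      apply: (@eq_computable _ (fun w =>
          \prod_(j < m) (0 < G j (w 0) (fun i => w i.+1)))).
        move=> w; case: ballP => [H|H].
          by rewrite big1 // => j _; rewrite H.
        apply/eqP; rewrite eqn0Ngt; apply/negP => p; apply: H => j ltj.
        by move: p; rewrite (bigD1 (Ordinal ltj)) //=; case: (0 < G j _ _).
      have : forall j, j < m -> computable n.+1 (fun w => G j (w 0) (fun i => w i.+1)).
        by move=> j /GP[].
      elim: m {f F cF mF hF g IHg G0 G0P GE GP} G => [|m IHm] G GP.
        by apply: (@eq_computable _ (fun=> 1)); [move=> w; rewrite big_ord0|rec_tac].
      apply: (@eq_computable _ (fun w => \prod_(j < m) (0 < G j (w 0) (fun i => w i.+1))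
            * (0 < G m (w 0) (fun i => w i.+1)))).
        by move=> w; rewrite big_ord_recr.
      apply: computable_mul; first by apply: IHm => j ltj; apply: GP; exact: leqW.
      by apply: computable_ltn; [rec_tac | exact: GP].
    apply: (@computable_comp m.+1 n.+1 _ (fun j => if j is j'.+1 then
         fun w => (G j' (w 0) (fun i => w i.+1)).-1 else fun w => w 0) cF) => -[_|j].
      by rec_tac.
    by rewrite ltnS => /GP[cG _]; rec_tac.
  + move=> v u s t y vu st; case: ballP => // H; rewrite mul1n => FE.
    have GE' j : j < m -> G j t u = G j s v.
      move=> ltj; have := H j ltj; case Ej : (G j s v) => [//|a] _.
      by have [_ mj] := GP _ ltj; exact: mj vu st Ej.
    have -> : ball m (fun j => 0 < G j t u).
      by apply/ballP => j ltj; rewrite GE' ?H.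
    rewrite mul1n; apply: mF st FE => j ltj.
    by rewrite GE'.
  + move=> v y /=; split=> [[w [gw fw]]|[s]].
      have [s Hs] : exists s, forall i t, i < m -> s <= t ->
          G i t v = (nth 0 w i).+1.
        apply: eventually_forall_lt => i lti; have := gw (Ordinal lti).
        have [_ mi hi] := G0P (Ordinal lti); rewrite hi => -[s Es].
        exists s => t st; rewrite (GE (Ordinal lti)) -(tnth_nth 0 w (Ordinal lti)).
        exact: mi st Es.
      move: fw; rewrite -[w]args_nth hF => -[t Et]; exists (maxn s t).
      have -> : ball m (fun j => 0 < G j (maxn s t) v).
        by apply/ballP => j ltj; rewrite Hs ?leq_maxl.
      rewrite mul1n; apply: mF (leq_maxr s t) Et => j ltj.
      by rewrite Hs ?leq_maxl.
    case: ballP => // H; rewrite mul1n => FE.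
    exists (args m (fun j => (G j s v).-1)); split; last by apply/hF; exists s.
    move=> i; rewrite tnth_mktuple; have [_ _ hi] := G0P i; apply/hi; exists s.
    by rewrite -GE prednK // H.
(* An accumulator 0 means that an earlier value is still missing; otherwise its predecessor is the
   latest value. *)
- exists (fun s v => nat_rect (fun=> nat) (F s (fun i => v i.+1))
    (fun i z => if z == 0 then 0 else G s (scons i (scons z.-1 (fun i => v i.+1)))) (v 0)).
  (* [step] extracts from a successful run the sequence of values that [Prec] asks for; [unstep] is
     the converse. *)
  have step s v (a : nat -> nat) k :
      nat_rect (fun=> nat) (F s v) (fun i z => if z == 0 then 0 else
        G s (scons i (scons z.-1 v))) k = (a k).+1 ->
      exists b : nat -> nat, [/\ b k = a k, F s v = (b 0).+1 &
        forall i, i < k -> G s (scons i (scons (b i) v)) = (b i.+1).+1].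
    elim: k a => [|k IHk] a /=; first by exists a.
    case: eqP => // /eqP; rewrite -lt0n => zp Ez.
    pose z := nat_rect (fun=> nat) (F s v) (fun i z => if z == 0 then 0 else
        G s (scons i (scons z.-1 v))) k.
    have [|b [bk b0 bS]] := IHk (fun=> z.-1); first by rewrite prednK.
    exists (fun i => if i <= k then b i else a k.+1); split=> [||i].
    + by rewrite ltnn.
    + by [].
    + rewrite ltnS => le; rewrite le; move: le; rewrite leq_eqVlt.
      case/orP=> [/eqP->|lt]; first by rewrite ltnn bk.
      by rewrite lt; apply: bS.
  have unstep s v (b : nat -> nat) k : F s v = (b 0).+1 ->
      (forall i, i < k -> G s (scons i (scons (b i) v)) = (b i.+1).+1) ->
      nat_rect (fun=> nat) (F s v) (fun i z => if z == 0 then 0 else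
        G s (scons i (scons z.-1 v))) k = (b k).+1.
    move=> b0; elim: k => [|k IHk] //= bS.
    by rewrite IHk ?bS //= => i lti; apply: bS; exact: ltnW.
  split.
  + apply: (@computable_rec n.+2 (fun w => w 1) (fun w => F (w 0) (fun i => w i.+2))
      (fun i z w => if z == 0 then 0 else
         G (w 0) (scons i (scons z.-1 (fun i => w i.+2))))).
    * by rec_tac.
    * apply: (@computable_comp n.+1 n.+2 _ (fun j => if j is j'.+1 then fun w => w j'.+2
        else fun w => w 0) cF) => -[_|j ltj]; first by rec_tac.
      exact: computable_var.
    apply: computable_if; rec_tac.
    apply: eq_computable; last apply: (@computable_comp n.+3 n.+4 _
       (fun j w => match j with 0 => w 2 | 1 => w 0 | 2 => (w 1).-1
                   | j'.+3 => w j'.+4 end) cG).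
      by move=> w /=; congr (G _ _); apply/funext => -[|[|i]].
    by move=> [|[|[|j]]] lt; rec_tac; exact: computable_var.
  + move=> v u s t y vu st /(step s _ (fun=> y))[b [bk b0 bS]].
    have -> : y = b (u 0) by rewrite -vu.
    apply: unstep.
      by apply: mF st b0 => i lti; exact: vu.
    move=> i lti; apply: mG st (bS i _); last by rewrite vu.
    by case=> [|[|j]] //=; rewrite !ltnS => lt; exact: vu.
  + move=> v y /=; rewrite thead_args behead_args; split=> [[b [b0 bS ->]]|[s Es]].
      have [s0 Es0] := (hF _ _).1 b0.
      have [s1 Es1] : exists s, forall i t, i < v 0 -> s <= t ->
          G t (scons i (scons (b i) (fun j => v j.+1))) = (b i.+1).+1.
        apply: eventually_forall_lt => i /bS; rewrite !cons_args hG => -[s Es].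
        by exists s => t st; exact: mG st Es.
      exists (maxn s0 s1); apply: unstep => [|i lti].
        by apply: mF (leq_maxl s0 s1) Es0.
      by apply: Es1 => //; exact: leq_maxr.
    have [b [bk b0 bS]] := step s _ (fun=> y) _ Es.
    exists b; split=> // [|i lti].
      by apply/hF; exists s.
    by rewrite !cons_args; apply/hG; exists s; exact: bS.
  (* The search stops at the first [y] where [F] is 0 (not evaluated yet) or 1 (value 0), and
     reports [y] only in the second case. *)
  exists (fun s v => let y := bmin s (fun y => F s (scons y v) <= 1) in
     if (y < s) && (F s (scons y v) == 1) then y.+1 else 0).
  have char s v y : (let y := bmin s (fun y => F s (scons y v) <= 1) in
     if (y < s) && (F s (scons y v) == 1) then y.+1 else 0) = y.+1 <->
     [/\ y < s, F s (scons y v) = 1 &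
         forall z, z < y -> exists a, F s (scons z v) = a.+2].
    have [le lt eq] := bminP s (fun y => F s (scons y v) <= 1); cbv zeta.
    split.
      case: ifP => // /andP[ys /eqP Fy] [<-]; split=> // z /lt.
      by case: (F s _) => [|[|a]] // _; exists a.
    move=> [ys Fy Fz]; suff -> : bmin s (fun y => F s (scons y v) <= 1) = y.
      by rewrite ys Fy.
    apply/eqP; case: ltngtP => // H.
      by have [a Ea] := Fz _ H; have := eq (ltn_trans H ys); rewrite Ea.
    by have := lt _ H; rewrite Fy.
  have cS : computable n.+2 (fun w => F (w 1) (scons (w 0) (fun i => w i.+2))).
    apply: eq_computable; last apply: (@computable_comp n.+2 n.+2 _
      (fun j w => match j with 0 => w 1 | 1 => w 0 | j'.+2 => w j'.+2 end) cF).
      by move=> w /=; congr (F _ _); apply/funext => -[|i].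
    by move=> [|[|j]] lt; rec_tac; exact: computable_var.
  have cB : computable n.+1
      (fun w => bmin (w 0) (fun y => F (w 0) (scons y (fun i => w i.+1)) <= 1)).
    apply: (@computable_bmin n.+1 (fun w => w 0)
      (fun y w => F (w 0) (scons y (fun i => w i.+1)) <= 1)); first by rec_tac.
    by apply: computable_leq; [exact: cS | rec_tac].
  split.
  + cbv zeta; apply: computable_if; [apply: computable_and|rec_tac|rec_tac].
      by apply: computable_ltn => //; rec_tac.
    apply: computable_eq; last by rec_tac.
    apply: (@computable_comp n.+2 n.+1 _ (fun j w => match j with
      0 => bmin (w 0) (fun y => F (w 0) (scons y (fun i => w i.+1)) <= 1)
      | j'.+1 => w j' end) cS) => -[_|j lt] //; exact: computable_var.
  + move=> v u s t y vu st; rewrite !char => -[ys Fy Fz].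
    have ext z i : i < n.+1 -> scons z v i = scons z u i.
      by case: i => // i lti; exact: vu.
    split; first exact: leq_trans st.
      exact: mF (ext y) st Fy.
    by move=> z /Fz[a Ea]; exists a; exact: mF (ext z) st Ea.
  + move=> v y /=; rewrite cons_args hF; split=> [[[s Es] H]|[s /char[ys Fy Fz]]].
      have [s1 Es1] : exists s, forall i t, i < y -> s <= t ->
          exists a, F t (scons i v) = a.+2.
        apply: eventually_forall_lt => i /H[a]; rewrite cons_args hF => -[s0 Es0].
        by exists s0 => t st; exists a; exact: mF st Es0.
      exists (maxn y.+1 (maxn s s1)); apply/char; split; first exact: leq_maxl.
        by apply: mF Es => //; rewrite !leq_max leqnn orbT.
      by move=> z ltz; apply: Es1 => //; rewrite !leq_max leqnn !orbT.
    split; first by exists s.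
    by move=> z /Fz[a Ea]; exists a; rewrite cons_args hF; exists s.
Qed.

(** * Enumeration in stages *)

Lemma re2_stages (R : nat -> set nat) : re2 R -> exists b : nat -> nat -> nat -> bool,
  [/\ computable 3 (fun v => b (v 0) (v 1) (v 2)),
      forall s t k x, s <= t -> b s k x -> b t k x
    & forall k x, R k x <-> exists s, b s k x].
Proof.
move=> [f fP]; have [E [cE mE hE]] := step_evaluator f.
exists (fun s k x => 0 < E s (scons k (scons x (fun=> 0)))); split.
- apply: computable_ltn; first by rec_tac.
  apply: eq_computable; last apply: (@computable_comp 3 3 _
     (fun i w => match i with 0 => w 0 | 1 => w 1 | 2 => w 2 | _ => 0 end) cE).
    by move=> v /=; congr (E _ _); apply/funext => -[|[|]].
  by move=> [|[|[|]]] //= _; rec_tac.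
- move=> s t k x st; case Es: (E s _) => [//|y] _.
  by rewrite (mE _ _ _ _ _ _ st Es).
- move=> k x; rewrite fP.
  have -> : [tuple k; x] = args 2 (scons k (scons x (fun=> 0))) by rewrite args2.
  split=> [[y /hE[s Es]]|[s]]; first by exists s; rewrite Es.
  by case Es: (E s _) => [//|y] _; exists y; apply/hE; exists s.
Qed.

Lemma computable_search n (b : nat -> (nat -> nat) -> bool) :
  computable n.+1 (fun w => b (w 0) (fun i => w i.+1)) ->
  exists f : recf n, forall v, (exists y, computes f (args n v) y) <-> exists s, b s v.
Proof.
(* [Mu] looks for a zero, hence the negated test. *)
move=> /computable_not[f fP]; exists (Mu f) => v.
have fz z : computes f (cons_tuple z (args n v)) (~~ b z v).
  by rewrite cons_args; exact: fP.
split=> [[y /= [fy _]]|exb].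
  by exists y; have := computes_fun fy (fz y); case: (b y v).
case: (ex_minnP exb) => y bv ymin; exists y; split=> [|z ltz].
  by have := fz y; rewrite bv.
by exists 0; have := fz z; case bz: (b z v) => //; have := ymin z bz; rewrite leqNgt ltz.
Qed.

Lemma re_of_stages (A : set nat) (b : nat -> nat -> bool) :
  computable 2 (fun v => b (v 0) (v 1)) ->
  (forall x, A x <-> exists s, b s x) -> re A.
Proof.
move=> cb AP.
have [f fP] := @computable_search 1 (fun s v => b s (v 0)) cb.
by exists f => x; rewrite AP -(fP (fun=> x)) args1.
Qed.

Lemma re2_of_stages (R : nat -> set nat) (b : nat -> nat -> nat -> bool) :
  computable 3 (fun v => b (v 0) (v 1) (v 2)) ->
  (forall k x, R k x <-> exists s, b s k x) -> re2 R.
Proof.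
move=> cb RP.
have [f fP] := @computable_search 2 (fun s v => b s (v 0) (v 1)) cb.
by exists f => k x; rewrite RP -(fP (scons k (fun=> x))) args2.
Qed.

Lemma recursiveP (h : nat -> nat) : recursive h <-> computable 1 (fun v => h (v 0)).
Proof.
split=> -[f fP]; exists f; first by move=> v; rewrite args1.
by move=> x; have := fP (fun=> x); rewrite args1.
Qed.

(** * The equivalence relation *)

Section Construction.

Variable w : nat -> nat -> nat -> bool.
Hypothesis w_computable : computable 3 (fun v => w (v 0) (v 1) (v 2)).
Hypothesis w_mono : forall s t e x, s <= t -> w s e x -> w t e x.

(** Throughout, [r] is meant to send each number to the least element of its class at stage [s];
    only numbers below [s] count as found by then. *)
Definition touches (s : nat) (r : nat -> nat) (e y : nat) : bool :=
  bex s (fun x => w s e x && (r x == y)).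

(** For a marker a_l this is its index [l]. *)
Definition rank (r : nat -> nat) (y : nat) : nat := bsum y (fun z => r z == z).

Definition mergeable (s : nat) (r : nat -> nat) (y x : nat) : bool :=
  [&& r y == y, r x == x &
      bex (rank r y) (fun e => touches s r e y && ~~ touches s r e x)].

(** The value [s] signals that no marker below [s] is to be merged away. *)
Definition victim (s : nat) (r : nat -> nat) : nat :=
  bmin s (fun y => bex y (fun x => mergeable s r y x)).

(* Equal to the victim itself when there is nothing to merge. *)
Definition target (s : nat) (r : nat -> nat) : nat :=
  bmin (victim s r) (fun x => mergeable s r (victim s r) x).

Definition merge (s : nat) (r : nat -> nat) (z : nat) : nat :=
  if r z == victim s r then target s r else r z.

Fixpoint rep (s : nat) : nat -> nat :=
  if s is t.+1 then merge t (rep t) else id.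

(** * Stagewise representatives and settled markers *)

Lemma target_le s r : target s r <= victim s r.
Proof. by have [] := bminP (victim s r) (fun x => mergeable s r (victim s r) x). Qed.

(** The target has passed the test of [mergeable], or it equals the victim, which has passed it too
    or is the still unmoved number [s]. *)
Lemma target_fix s r : (forall z, s <= z -> r z = z) -> r (target s r) = target s r.
Proof.
move=> rs; have [le _ ] := bminP (victim s r) (fun x => mergeable s r (victim s r) x).
rewrite -/(target s r) => Ht; case: (ltnP (target s r) (victim s r)) => [/Ht|ge].
  by case/and3P=> _ /eqP.
have Et : target s r = victim s r by apply/eqP; rewrite eqn_leq le.
have [vs _ Hv] := bminP s (fun y => bex y (fun x => mergeable s r y x)).
rewrite -/(victim s r) in vs Hv.
move: vs; rewrite leq_eqVlt => /orP[/eqP vs|/Hv/bexP[x ltx mx]].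
  by rewrite Et vs rs.
by rewrite Et; case/and3P: mx => /eqP.
Qed.

Lemma rep_large s z : s <= z -> rep s z = z.
Proof.
elim: s z => //= s IHs z sz; rewrite /merge (IHs _ (ltnW sz)).
have [vs _ _] := bminP s (fun y => bex y (fun x => mergeable s (rep s) y x)).
by case: eqP => // E; move: vs; rewrite -/(victim s (rep s)) -E leqNgt sz.
Qed.

Lemma repS_le s z : rep s.+1 z <= rep s z.
Proof. by rewrite /= /merge; case: eqP => // ->; exact: target_le. Qed.

Lemma rep_le s t z : s <= t -> rep t z <= rep s z.
Proof.
move=> /subnKC <-; elim: (t - s) => [|k IHk]; first by rewrite addn0.
by rewrite addnS; exact: leq_trans (repS_le _ _) IHk.
Qed.

Lemma rep_idem s z : rep s (rep s z) = rep s z.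
Proof.
elim: s z => //= s IHs z; have Et := target_fix (@rep_large s).
rewrite /merge; case: (rep s z =P _) => E; last first.
  by rewrite IHs; move/eqP/negbTE: E => ->.
by rewrite Et; case: ifP.
Qed.

Lemma rep_eq s t x y : s <= t -> rep s x = rep s y -> rep t x = rep t y.
Proof.
move=> /subnKC <- E; elim: (t - s) => [|k IHk]; first by rewrite addn0.
by rewrite addnS /= /merge IHk.
Qed.

(** Representatives never increase and start at [z], so [z] cannot lose its role and regain it. *)
Lemma rep_fix s t z : s <= t -> rep t z = z -> rep s z = z.
Proof.
move=> st Et; apply/eqP; rewrite eqn_leq -{3}Et (rep_le z st) andbT.
by have := rep_le z (leq0n s).
Qed.

Definition theta (x y : nat) : Prop := exists s, rep s x = rep s y.

(** The settled markers, that is, the least elements of the classes of [theta]. *)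
Definition final (y : nat) : Prop := forall s, rep s y = y.

Lemma theta_equiv : RelationClasses.Equivalence theta.
Proof.
split=> [x|x y [s E]|x y z [s E] [t F]]; first by exists 0.
  by exists s.
exists (maxn s t); rewrite (rep_eq (leq_maxl s t) E).
exact: rep_eq (leq_maxr s t) F.
Qed.

Lemma not_final y : ~ final y -> exists s, forall t, s <= t -> rep t y != y.
Proof.
move=> /existsNP[s Es]; exists s => t st; apply/eqP => /(rep_fix st); exact: Es.
Qed.

Lemma theta_rep s x : theta x (rep s x).
Proof. by exists s; rewrite rep_idem. Qed.

(** The representatives of [x] never increase, so they stay at their minimum from some stage on;
    idempotence makes this value final. *)
Lemma rep_stabilizes x : exists y s, final y /\ forall t, s <= t -> rep t x = y.
Proof.
have [m [s <-] ms] : exists2 m, exists s, rep s x = m & forall s, m <= rep s x.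
  have ex : exists m, `[< exists s, rep s x = m >].
    by exists (rep 0 x); apply/asboolP; exists 0.
  case: (ex_minnP ex) => m /asboolP mP mmin; exists m => // s.
  by apply: mmin; apply/asboolP; exists s.
have H t : s <= t -> rep t x = rep s x.
  by move=> st; apply/eqP; rewrite eqn_leq ms rep_le.
exists (rep s x), s; split=> // t; case: (leqP s t) => [st|/ltnW ts].
  by rewrite -{1}(H t st) rep_idem H.
by apply: (rep_fix ts); rewrite rep_idem.
Qed.

Lemma final_rep x : exists2 y, final y & theta x y.
Proof.
have [y [s [fy Hs]]] := rep_stabilizes x.
by exists y => //; rewrite -(Hs s) //; exact: theta_rep.
Qed.

Lemma final_inj x y : final x -> final y -> theta x y -> x = y.
Proof. by move=> fx fy [s]; rewrite fx fy. Qed.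

(** As long as [y] is not merged away, its class only grows. *)
Lemma touches_mono s t e y : s <= t -> rep t y = y ->
  touches s (rep s) e y -> touches t (rep t) e y.
Proof.
move=> st Ey /bexP[x xs /andP[wx /eqP Ex]]; apply/bexP; exists x.
  exact: leq_trans st.
rewrite (w_mono st wx) /=; have : rep s x = rep s y by rewrite Ex (rep_fix st Ey).
by move/(rep_eq st) ->; rewrite Ey.
Qed.

Lemma rank_mono s t y : s <= t -> rank (rep t) y <= rank (rep s) y.
Proof.
move=> st; rewrite /rank /bsum; apply: leq_sum => i _.
by case: eqP => // /(rep_fix st)/eqP ->.
Qed.

Lemma victim_mergeable s y : rep s.+1 y != y -> rep s y = y ->
  exists x, [/\ x < y, rep s x = x, mergeable s (rep s) y x & rep s.+1 y = x].
Proof.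
move=> /[swap] Ey; rewrite /= /merge Ey; case: (y =P victim _ _) => [E|]; last by rewrite eqxx.
move=> ty; have [le _ /(_ _)Ht] :=
  bminP (victim s (rep s)) (fun x => mergeable s (rep s) (victim s (rep s)) x).
exists (target s (rep s)); rewrite -/(target s (rep s)) -E in le Ht *.
have lt : target s (rep s) < y by rewrite ltn_neqAle ty.
by split=> //; [apply: target_fix (@rep_large s)|apply: Ht].
Qed.

(* If the final elements were bounded, consider the least other element [y]
   that is still a representative once everything about the final ones has
   settled. It is merged later through some index below their number, which
   makes the class of a final element meet a new set. *)
Lemma final_unbounded N : exists2 y, N <= y & final y.
Proof.
apply: contrapT => nex.
have finN y : final y -> y < N.
  by move=> fy; rewrite ltnNge; apply/negP => Ny; apply: nex; exists y.
(* From [s0] on, the only representatives below [N] are final ones. *)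
have [s0 Hs0] : exists s, forall y t, y < N -> s <= t -> rep t y = y -> final y.
  apply: eventually_forall_lt => y _; have [fy|/not_final[s Hs]] := pselect (final y).
    by exists 0.
  by exists s => t /Hs/eqP.
(* From [s1] on, no index below [N] meets the class of a further final element. *)
have [s1 Hs1] : exists s, forall e t, e < N -> s <= t -> forall x, x < N -> final x ->
    touches t (rep t) e x -> touches s (rep s) e x.
  have H e : e < N -> exists s, forall t, s <= t -> forall x, x < N -> final x ->
      touches t (rep t) e x -> touches s (rep s) e x.
    move=> _.
    have [s Hs] : exists s, forall x t, x < N -> s <= t -> final x ->
        forall u, touches u (rep u) e x -> touches t (rep t) e x.
      apply: eventually_forall_lt => x _.
      have [[s Hs]|nex'] := pselect (exists s, touches s (rep s) e x).
        by exists s => t st fx u _; exact: touches_mono (fx t) Hs.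
      by exists 0 => t _ _ u Hu; case: nex'; exists u.
    by exists s => t _ x ltx fx; exact: Hs.
  have [s Hs] : exists s, forall e t, e < N -> s <= t -> forall x, x < N -> final x ->
    forall u, touches u (rep u) e x -> touches t (rep t) e x.
    apply: eventually_forall_lt => e /H[s Hs]; exists s => t st x ltx fx u Hu.
    apply: (touches_mono st (fx t)).
    case: (leqP s u) => [su|/ltnW us]; first exact: Hs su _ ltx fx Hu.
    exact: touches_mono (fx s) Hu.
  by exists s => e t lte _ x ltx fx; exact: Hs.
pose s := maxn s0 s1.
have exy : exists y, (N <= y) && (rep s y == y).
  by exists (maxn N s); rewrite leq_maxl rep_large ?leq_maxr ?eqxx.
case: (ex_minnP exy) => y /andP[Ny /eqP Ey] ymin.
have nfy : ~ final y by move=> /finN; rewrite ltnNge Ny.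
have exu : exists u, rep u y != y by have [u Hu] := not_final nfy; exists u; exact: Hu.
case: (ex_minnP exu) => -[|u] Eu umin; first by rewrite eqxx in Eu.
have su : s <= u.
  rewrite -ltnS ltnNge; apply/negP => us; move/eqP: Eu; apply.
  exact: rep_fix us Ey.
have Euy : rep u y = y by apply/eqP/negPn/negP => /umin; rewrite ltnn.
have lowfin z : z < y -> rep u z = z -> z < N /\ final z.
  move=> ltz Ez; have ltN : z < N.
    rewrite ltnNge; apply/negP => Nz; have := ymin z.
    by rewrite Nz (rep_fix su Ez) eqxx leqNgt ltz => /(_ isT).
  by split=> //; apply: Hs0 Ez => //; apply: leq_trans su; exact: leq_maxl.
have [x [ltx Ex /and3P[_ _ /bexP[e lte /andP[my nmx]]] Eyx]] := victim_mergeable Eu Euy.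
(* By [lowfin] all representatives below [y] lie below [N], so the rank of [y] is at most [N]. *)
have eN : e < N.
  apply: leq_trans lte _; rewrite /rank /bsum -(subnKC Ny) big_split_ord /=.
  rewrite [X in _ + X]big1 ?addn0 => [|i _].
    by rewrite -[leqRHS]card_ord -sum1_card leq_sum // => i _; exact: leq_b1.
  apply/eqP; rewrite eqb0; apply/eqP => Ei.
  have : N + i < y by have := ltn_ord i; rewrite ltn_subRL.
  by move/lowfin => /(_ Ei)[]; rewrite ltnNge leq_addr.
have [xN fx] := lowfin _ ltx Ex.
have s1u : s1 <= u by apply: leq_trans su; exact: leq_maxr.
(* The merge hands the element found in the class of [y] over to the class of [x], against the
   choice of [s1]. *)
have : touches u.+1 (rep u.+1) e x.
  case/bexP: my => z zu /andP[wz /eqP Ez]; apply/bexP; exists z; first exact: leqW.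
  rewrite (w_mono (leqnSn u) wz) -Eyx; apply/eqP.
  by apply: (rep_eq (leqnSn u)); rewrite Ez Euy.
move/(Hs1 _ _ eN (leqW s1u) _ xN fx)/(touches_mono s1u (fx u)).
exact/negP.
Qed.

(** Each further final element raises, at all stages, the rank of everything above it. *)
Lemma rank_large e : exists N, forall y s, N <= y -> e < rank (rep s) y.
Proof.
have rank_le s y z : y <= z -> rank (rep s) y <= rank (rep s) z.
  by move=> /subnKC <-; rewrite /rank /bsum big_split_ord leq_addr.
have step N k : (forall y s, N <= y -> k <= rank (rep s) y) ->
    exists N', forall y s, N' <= y -> k < rank (rep s) y.
  move=> H; have [z Nz fz] := final_unbounded N; exists z.+1 => y s zy.
  apply: leq_trans (rank_le s _ _ zy); rewrite /rank bsumS fz eqxx addn1 ltnS.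
  exact: H.
elim: e => [|e [N HN]]; first by apply: (@step 0).
exact: (@step N).
Qed.

(* Otherwise from some stage on an element up to [y] would be merged at every
   stage, and the rank of [y] would decrease forever. *)
Lemma final_touches_below e x y : final x -> final y -> x < y ->
  (forall s, e < rank (rep s) y) ->
  (exists s, touches s (rep s) e y) -> exists s, touches s (rep s) e x.
Proof.
move=> fx fy xy ltr [s my]; apply: contrapT => nmx.
(* From here on the class of [y] is met and [y] lies within the range searched for a victim. *)
pose s1 := maxn s y.+1.
have drop t : s1 <= t -> rank (rep t.+1) y < rank (rep t) y.
  rewrite geq_max => /andP[st yt].
  have my' := touches_mono st (fy t) my.
  have cxy : bex y (fun x => mergeable t (rep t) y x).
    apply/bexP; exists x => //; rewrite /mergeable fx fy !eqxx /=.
    apply/bexP; exists e => //; rewrite my' /=; apply/negP => mx.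
    by apply: nmx; exists t.
  have [_ vmin vP] := bminP t (fun y => bex y (fun x => mergeable t (rep t) y x)).
  rewrite -/(victim t (rep t)) in vmin vP.
  have vy : victim t (rep t) <= y.
    by rewrite leqNgt; apply/negP => /vmin; rewrite cxy.
  have vt := leq_ltn_trans vy yt.
  have /bexP[z zv mz] := vP vt.
  have [_ _ tP] := bminP (victim t (rep t))
    (fun x => mergeable t (rep t) (victim t (rep t)) x).
  have tv : target t (rep t) < victim t (rep t).
    have [_ tmin _] := bminP (victim t (rep t))
      (fun x => mergeable t (rep t) (victim t (rep t)) x).
    apply: leq_ltn_trans zv; rewrite leqNgt; apply/negP => /tmin; by rewrite mz.
  have Ev : rep t (victim t (rep t)) = victim t (rep t).
    by case/and3P: mz => /eqP.
  have Ev' : rep t.+1 (victim t (rep t)) = target t (rep t).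
    by rewrite /= /merge Ev eqxx.
  (* A final [y] is never moved, so the victim lies strictly below [y] and is counted in its
     rank. *)
  have ltv : victim t (rep t) < y.
    rewrite ltn_neqAle vy andbT; apply/eqP => E.
    by move: Ev'; rewrite E fy => E'; rewrite -{1}E' E ltnn in tv.
  have rankD u : rank (rep u) y = (rep u (victim t (rep t)) == victim t (rep t))
      + \sum_(i < y | i != Ordinal ltv) (rep u i == i).
    by rewrite /rank /bsum (bigD1 (Ordinal ltv)).
  rewrite !rankD Ev Ev' eqxx (ltn_eqF tv) add0n add1n ltnS; apply: leq_sum => i _.
  by case: (rep t.+1 i =P _) => // /(rep_fix (leqnSn t))/eqP ->.
have : forall k, rank (rep (s1 + k)) y + k <= rank (rep s1) y.
  elim=> [|k IHk]; first by rewrite !addn0.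
  apply: leq_trans IHk; rewrite !addnS -addSn leq_add2r; exact/drop/leq_addr.
move=> /(_ (rank (rep s1) y).+1).
by rewrite leqNgt addnS ltnS leq_addl.
Qed.


(** * Computability of the construction *)

(** The base-[B] numeral with digits [r 0, ..., r n.-1], least significant first. *)
Definition digits (B n : nat) (r : nat -> nat) : nat := bsum n (fun z => r z * B ^ z).

Lemma digits_lt B n r : (forall z, z < n -> r z < B) -> digits B n r < B ^ n.
Proof.
elim: n => [|n IHn] H; first by rewrite /digits bsum0.
rewrite /digits bsumS -/(digits B n r) expnS.
apply: leq_trans (_ : (r n).+1 * B ^ n <= _); last by rewrite leq_mul2r H ?orbT.
by rewrite mulSn -addSn leq_add2r IHn // => z zn; apply: H; exact: leqW.
Qed.

Lemma digitsE B n r x : (forall z, z < n -> r z < B) -> x < n ->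
  digits B n r %/ B ^ x %% B = r x.
Proof.
elim: n => // n IHn H; rewrite ltnS /digits bsumS -/(digits B n r) => xn.
have H' z : z < n -> r z < B by move=> zn; apply: H; exact: leqW.
have B0 : 0 < B by exact: leq_ltn_trans (H n (leqnn _)).
move: xn; rewrite leq_eqVlt => /orP[/eqP->|xn].
  by rewrite addnC divnMDl ?expn_gt0 ?B0 // divn_small ?digits_lt // addn0 modn_small ?H.
have -> : B ^ n = B * B ^ (n - x.+1) * B ^ x.
  by rewrite -expnS -expnD addSnnS subnK.
by rewrite mulnA divnDMl ?expn_gt0 ?B0 // mulnCA -modnDm modnMr addn0 modn_mod IHn.
Qed.

(* A stage of the construction is coded by a number: [rep s z] is the [z]-th
   digit in base [s.+1] when [z < s], and [z] otherwise. *)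
Definition lookup (s a z : nat) : nat := if z < s then a %/ s.+1 ^ z %% s.+1 else z.

(** Primitive recursion passes on numbers only, so each stage map is carried along as a numeral. *)
Definition code_rep (s : nat) : nat :=
  nat_rect (fun=> nat) 0 (fun t a => digits t.+2 t.+1 (merge t (lookup t a))) s.

Lemma lookup_code s : lookup s (code_rep s) = rep s.
Proof.
elim: s => [|s IHs]; first exact/funext.
apply/funext => z; rewrite /lookup /= IHs.
case: (ltnP z s.+1) => [zs|sz]; last by rewrite -/(rep s.+1) rep_large.
rewrite digitsE // => y ys; rewrite -/(rep s.+1 y) ltnS.
by apply: leq_trans (rep_le y (leq0n _)) _; rewrite ltnW.
Qed.

Lemma computable_w n a b c : computable n a -> computable n b -> computable n c ->
  computable n (fun v => w (a v) (b v) (c v)).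
Proof. exact: (@computable_app3 n (fun s e x => w s e x) a b c w_computable). Qed.

Lemma computable_touches n s c e y : computable n s -> computable n c ->
  computable n e -> computable n y ->
  computable n (fun v => touches (s v) (lookup (s v) (c v)) (e v) (y v)).
Proof.
move=> Hs Hc He Hy.
have H4 : computable 4 (fun v => touches (v 0) (lookup (v 0) (v 1)) (v 2) (v 3)).
  by rewrite /touches /lookup; rec_tac; apply: computable_w; rec_tac.
apply: (@computable_comp 4 n _ (fun i => match i with
  0 => s | 1 => c | 2 => e | _ => y end) H4).
by do 4?case=> //.
Qed.

Lemma computable_rank n s c y : computable n s -> computable n c -> computable n y ->
  computable n (fun v => rank (lookup (s v) (c v)) (y v)).
Proof.
apply: (@computable_app3 n (fun s c y => rank (lookup s c) y)).
by rewrite /rank /lookup; rec_tac.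
Qed.

Lemma computable_lookup n s c y : computable n s -> computable n c -> computable n y ->
  computable n (fun v => lookup (s v) (c v) (y v)).
Proof.
apply: (@computable_app3 n (fun s c y => lookup s c y)).
by rewrite /lookup; rec_tac.
Qed.

Ltac stage_tac := repeat first [done | lazymatch goal with
 | |- computable _ (fun v => lookup (@?s v) (@?c v) (@?y v)) => apply: computable_lookup
 | |- computable _ (fun v => rank (lookup (@?s v) (@?c v)) (@?y v)) =>
     apply: computable_rank
 | |- computable _ (fun v =>
     nat_of_bool (touches (@?s v) (lookup _ (@?c v)) (@?e v) (@?y v))) =>
     apply: computable_touches
 | |- computable _ (fun v => nat_of_bool (w (@?s v) (@?e v) (@?y v))) =>
     apply: computable_w
 | _ => rec_step end].

Lemma computable_merge : computable 3 (fun v => merge (v 0) (lookup (v 0) (v 1)) (v 2)).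
Proof.
have cM n s c y x : computable n s -> computable n c -> computable n y ->
    computable n x ->
    computable n (fun v => mergeable (s v) (lookup (s v) (c v)) (y v) (x v)).
  move=> Hs Hc Hy Hx.
  have H4 : computable 4 (fun v => mergeable (v 0) (lookup (v 0) (v 1)) (v 2) (v 3)).
    by rewrite /mergeable; stage_tac.
  apply: (@computable_comp 4 n _ (fun i => match i with
    0 => s | 1 => c | 2 => y | _ => x end) H4).
  by do 4?case=> //.
have cV n s c : computable n s -> computable n c ->
    computable n (fun v => victim (s v) (lookup (s v) (c v))).
  apply: (@computable_app2 n (fun s c => victim s (lookup s c))).
  by rewrite /victim; stage_tac; apply: cM; stage_tac.
have cT n s c : computable n s -> computable n c ->
    computable n (fun v => target (s v) (lookup (s v) (c v))).
  apply: (@computable_app2 n (fun s c => target s (lookup s c))).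
  rewrite /target; apply: computable_bmin; first by apply: cV; stage_tac.
  by apply: cM; stage_tac; apply: cV; stage_tac.
by rewrite /merge; stage_tac; [apply: cV|apply: cT]; stage_tac.
Qed.

Lemma computable_code_rep : computable 1 (fun v => code_rep (v 0)).
Proof.
rewrite /code_rep /digits; stage_tac.
apply: (@computable_app3 _ (fun s c z => merge s (lookup s c) z)); stage_tac.
exact: computable_merge.
Qed.

Lemma computable_rep n s y : computable n s -> computable n y ->
  computable n (fun v => rep (s v) (y v)).
Proof.
move=> Hs Hy; apply: (@eq_computable _ (fun v => lookup (s v) (code_rep (s v)) (y v))).
  by move=> v; rewrite lookup_code.
apply: computable_lookup => //.
exact: (@computable_app1 n code_rep s computable_code_rep).
Qed.

Lemma theta_re2 : re2 theta.
Proof.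
apply: (@re2_of_stages _ (fun s x y => rep s x == rep s y)) => [|x y].
  by rec_tac; apply: computable_rep; rec_tac.
by split=> -[s] => [E|/eqP E]; exists s => //; apply/eqP.
Qed.

(** An index [e < rank r y] is one that can cause a merge of [y], so a lasting hit of a final [y]
    must in the end come with hits of all markers below. For rank at most [e] nothing of the kind is
    demanded. *)
Definition accepted (s : nat) (r : nat -> nat) (e y : nat) : bool :=
  [&& r y == y, touches s r e y &
      (rank r y <= e) || ball y (fun x => (r x == x) ==> touches s r e x)].

(* The classes met by W_e, read off at stage [s] as a bit mask. Momentary
   classes of large rank are only counted once all classes below are met. *)
Definition guess (e s : nat) : nat := digits 2 s (accepted s (rep s) e).

Lemma computable_guess : computable 2 (fun v => guess (v 0) (v 1)).
Proof.
apply: (@eq_computable _ (fun v => digits 2 (v 1)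
   (accepted (v 1) (lookup (v 1) (code_rep (v 1))) (v 0)))).
  by move=> v; rewrite lookup_code.
rewrite /accepted /digits; stage_tac; apply: (computable_app1 computable_code_rep);
stage_tac.
Qed.

End Construction.

(** * Families of closed sets and learners *)

Lemma finite_nat_bounded (A : set nat) : finite_set A -> exists N, forall x, A x -> x < N.
Proof.
move=> /finite_seqP[s ->]; exists (\max_(i <- s) i).+1 => x /= xs.
by rewrite ltnS; exact: leq_bigmax_seq.
Qed.

Lemma finite_image_inj (T U : Type) (A : set T) (f : T -> U) :
  (forall x y, A x -> A y -> f x = f y -> x = y) ->
  finite_set (f @` A) -> finite_set A.
Proof.
move=> inj; rewrite (eq_finite_set (inj_card_eq _)) // => x y /set_mem Ax /set_mem Ay.
exact: inj.
Qed.

Lemma eta_closedP (eta : nat -> set nat) : RelationClasses.Equivalence eta ->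
  forall A, eta_closed eta A <-> forall x y, eta x y -> A x -> A y.
Proof.
move=> [refl sym trans] A; split=> [[F [FC ->]] x y xy [C FC' Cx]|H].
  by exists C => //; have [a _ Ea] := FC _ FC'; rewrite -Ea in Cx *; exact: trans Cx xy.
exists (eta @` A); split=> [_ [x _ <-]|]; first by exists x.
apply/seteqP; split=> [x Ax|x [_ [y Ay <-] yx]]; last exact: H yx Ay.
by exists (eta x); [exists x | exact: refl].
Qed.

Lemma correct_fun eta W o L L' : correct eta W o L -> correct eta W o L' -> L = L'.
Proof. by move=> [e [-> <-]] [e' [[<-] <-]]. Qed.

Lemma ex_bc eta W M C : ex_learns eta W M C -> bc_learns eta W M C.
Proof.
move=> exM L T CL TL; have [o [co [n0 Hn0]]] := exM L T CL TL.
by exists n0 => n /Hn0 ->.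
Qed.

(* A text that follows the members of the chain one after the other, each time
   until the learner has found the current member. *)
Lemma chain_text eta W M (c : nat -> set nat) :
  (forall n x, x < n -> c n x) -> bc_learns eta W M (range c) ->
  exists T, text_for T [set: nat] /\ forall n0, exists n i,
    [/\ n0 <= n, n0 <= i & correct eta W (M (init_seg T n)) (c i)].
Proof.
move=> c_large bcM.
have next (p : seq (option nat) * nat) : exists q,
    [/\ prefix p.1 q, size p.1 < size q, Some p.2 \in q &
        exists2 i, p.2 <= i & correct eta W (M q) (c i)].
  (* Appending [k] in round [k] makes the final text exhaust all numbers. *)
  case: p => q k /=; pose q' := rcons q (Some k).
  (* By [c_large], [c i] contains every entry of [q'], which therefore extends to a text for
     [c i]. *)
  pose i := (maxn k (\max_(x <- pmap id q) x)).+1.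
  have ci x : Some x \in q' -> c i x.
    rewrite mem_rcons inE => H; apply: c_large; rewrite ltnS leq_max; case/orP: H.
      by move=> /eqP[->]; rewrite leqnn.
    move=> qx; apply/orP; right; apply: leq_bigmax_seq => //.
    by rewrite mem_pmap map_id.
  (* Beyond [q'] the default value, which depends on [n], enumerates [c i] with pauses at the
     non-members. *)
  pose T n := nth (if `[< c i (n - size q') >] then Some (n - size q') else None) q' n.
  have Tq n : n < size q' -> T n = nth None q' n.
    by move=> nq; rewrite /T (set_nth_default None).
  have TL : text_for T (c i).
    apply/seteqP; split=> [x [n]|x cx].
      case: (ltnP n (size q')) => nq.
        by rewrite Tq // => E; apply: ci; rewrite -E mem_nth.
      by rewrite /T nth_default //; case: asboolP => // cx [<-].
    by exists (x + size q'); rewrite /T nth_default ?leq_addl // addnK asboolT.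
  have Cc : range c (c i) by exists i.
  have [n0 Hn0] := bcM _ _ Cc TL.
  pose n := maxn n0 (size q').
  have En : init_seg T n = q' ++ mkseq (fun j => T (size q' + j)) (n - size q').
    have nq : size q' <= n := leq_maxr _ _.
    rewrite /init_seg -{1}(subnKC nq) /mkseq iotaD map_cat add0n.
    congr (_ ++ _); last by rewrite -[X in iota X](addn0) iotaDl -map_comp.
    apply: (@eq_from_nth _ None); rewrite size_map size_iota // => j jq.
    by rewrite (nth_map 0) ?size_iota // nth_iota // Tq.
  exists (init_seg T n); split.
  - by rewrite En /q' -cats1 -catA prefix_prefix.
  - by rewrite size_mkseq leq_max /q' size_rcons leqnn orbT.
  - by rewrite En mem_cat mem_rcons inE eqxx.
  - exists i; first by rewrite ltnW // ltnS leq_maxl.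
    by apply: Hn0; exact: leq_maxl.
have [f fP] := choice next.
pose q := fix q n := if n is k.+1 then f (q k, k) else [::].
have qS n : prefix (q n) (q n.+1) by have [] := fP (q n, n).
have q_prefix m n : m <= n -> prefix (q m) (q n).
  move=> /subnKC <-; elim: (n - m) => [|k IHk]; first by rewrite addn0 prefix_refl.
  by rewrite addnS; apply: prefix_trans IHk (qS _).
have q_size n : n <= size (q n).
  by elim: n => // n IHn; have [_ + _ _] := fP (q n, n); exact: leq_ltn_trans.
have q_nth m n j : m <= n -> j < size (q m) -> nth None (q n) j = nth None (q m) j.
  by move=> /q_prefix/prefixP[t ->] jm; rewrite nth_cat jm.
(* [q n.+1] is longer than [n], and all later segments agree with it. *)
pose T n := nth None (q n.+1) n.
have Tq n : init_seg T (size (q n)) = q n.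
  apply: (@eq_from_nth _ None); rewrite size_mkseq // => j jq.
  rewrite nth_mkseq // /T; case: (leqP j.+1 n) => le.
    by rewrite -(q_nth _ n).
  by rewrite (q_nth n) // ltnW.
exists T; split.
  apply/seteqP; split=> // k _; have [_ _ + _] := fP (q k, k).
  by rewrite -[f _]/(q k.+1) -(Tq k.+1) => /mapP[n _ En]; exists n.
move=> n0; have [_ _ _ [i ni ci]] := fP (q n0, n0).
exists (size (q n0.+1)), i; split=> //; first exact: ltnW (q_size _).
by rewrite Tq.
Qed.

(** * The dichotomy for r.e. closed sets *)

Section Consequences.

Variables (W : nat -> set nat) (w : nat -> nat -> nat -> bool).
Hypothesis hW : acceptable_numbering W.
Hypothesis w_computable : computable 3 (fun v => w (v 0) (v 1) (v 2)).
Hypothesis w_mono : forall s t e x, s <= t -> w s e x -> w t e x.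
Hypothesis wP : forall e x, W e x <-> exists s, w s e x.

Notation rep := (rep w).
Notation theta := (theta w : nat -> set nat).
Notation final := (final w).
Notation touches := (touches w).
Notation accepted := (accepted w).
Notation guess := (guess w).
Notation closed A := (forall x y, theta x y -> A x -> A y).
(** For closed [A] this expresses that [A] consists of finitely many classes. *)
Notation bounded A := (exists N, forall y, final y -> A y -> y < N).

Let theta_refl x : theta x x. Proof. by have [H _ _] := theta_equiv w; exact: H. Qed.
Let theta_sym x y : theta x y -> theta y x.
Proof. by have [_ H _] := theta_equiv w; exact: H. Qed.
Let theta_trans x y z : theta x y -> theta y z -> theta x z.
Proof. by have [_ _ H] := theta_equiv w; exact: H. Qed.

Lemma theta_eq x y : theta x y -> theta x = theta y.
Proof.
move=> xy; apply/seteqP; split=> z; last exact: theta_trans.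
exact/theta_trans/theta_sym.
Qed.

Lemma closure_closed A : closed (eta_closure theta A).
Proof. by move=> x y xy [a Aa ax]; exists a => //; exact: theta_trans ax xy. Qed.

Lemma closure_id (A : set nat) : closed A -> eta_closure theta A = A.
Proof.
move=> cA; apply/seteqP; split=> [x [a Aa ax]|x Ax]; first exact: cA ax Aa.
by exists x.
Qed.

Lemma closed_ext (A B : set nat) : closed A -> closed B ->
  (forall y, final y -> (A y <-> B y)) -> A = B.
Proof.
move=> cA cB AB; apply/seteqP; split=> x; have [y fy xy] := final_rep w x.
  by move=> /(cA _ _ xy)/(AB _ fy); apply: cB; exact: theta_sym.
by move=> /(cB _ _ xy)/(AB _ fy); apply: cA; exact: theta_sym.
Qed.

Lemma touches_closure e y : final y ->
  (exists s, touches s (rep s) e y) <-> eta_closure theta (W e) y.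
Proof.
move=> fy; split=> [[s /bexP[x xs /andP[wx /eqP Ex]]]|[x /wP[s wx] [t Et]]].
  by exists x; [apply/wP; exists s | exists s; rewrite Ex fy].
pose u := maxn x.+1 (maxn s t); exists u; apply/bexP; exists x; first exact: leq_maxl.
rewrite (w_mono _ wx) /=; last by rewrite /u !leq_max leqnn orbT.
by rewrite -[eqbRHS](fy u); apply/eqP/(rep_eq _ Et); rewrite /u !leq_max leqnn !orbT.
Qed.

(** If the markers in the closure are unbounded, above any settled [x] there is one whose rank
    always exceeds [e]; this forces [x] in as well. *)
Lemma closure_dichotomy e :
  bounded (eta_closure theta (W e)) \/ eta_closure theta (W e) = [set: nat].
Proof.
have [|unb] := pselect (bounded (eta_closure theta (W e))); first by left.
right; apply: closed_ext => // [|x fx]; first exact: closure_closed.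
split=> // _; have [N HN] := rank_large w_mono e.
have [y [fy Ay lty]] : exists y, [/\ final y, eta_closure theta (W e) y & maxn N x.+1 <= y].
  apply: contrapT => nex; apply: unb; exists (maxn N x.+1) => y fy Ay.
  by rewrite ltnNge; apply/negP => lty; apply: nex; exists y.
move: lty; rewrite geq_max => /andP[Ny xy].
apply/(touches_closure _ fx); apply: (final_touches_below w_mono fx fy xy).
  by move=> s; exact: HN.
exact/touches_closure.
Qed.

Lemma re_dichotomy A : re A -> closed A -> bounded A \/ A = [set: nat].
Proof.
move=> /(let: And3 _ h _ := hW in h A)[e <-] cA.
by have := closure_dichotomy e; rewrite closure_id.
Qed.

Lemma bounded_eta_finite (A : set nat) : closed A -> bounded A -> eta_finite theta A.
Proof.
move=> cA [N HN]; exists (theta @` [set y | A y /\ final y]); split.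
- by move=> _ [y _ <-]; exists y.
- apply: finite_image; apply: (@sub_finite_set _ _ `I_N) => //.
  by move=> y [Ay fy]; exact: HN.
apply/seteqP; split=> [x Ax|x [_ [y [Ay _] <-]]]; last by move=> yx; exact: cA yx Ay.
have [y fy xy] := final_rep w x; exists (theta y); last exact: theta_sym.
by exists y => //; split=> //; exact: cA xy Ax.
Qed.

Lemma eta_infinite_unbounded A : eta_infinite theta A -> ~ bounded A.
Proof.
move=> [F [FC infF EA]] [N HN]; apply: infF.
apply: (@sub_finite_set _ _ (theta @` `I_N)); last exact: finite_image.
move=> C FC'; have [a _ Ea] := FC _ FC'; have [y fy ay] := final_rep w a.
exists y; last by rewrite -Ea (theta_eq ay).
by apply: HN fy _; rewrite EA; exists C => //; rewrite -Ea.
Qed.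

Lemma theta_classes_infinite : infinite_set (classes theta).
Proof.
move=> fin; have : finite_set (theta @` final).
  by apply: sub_finite_set fin => _ [x _ <-]; exists x.
move/finite_image_inj => /(_ _)/finite_nat_bounded[|N HN].
  by move=> x y fx fy E; apply: (final_inj fx fy); rewrite E.
have [y Ny /HN] := final_unbounded w_mono N.
by rewrite ltnNge Ny.
Qed.

Lemma theta_positive : positive_equivalence theta.
Proof.
split; [exact: theta_equiv | exact: theta_re2 | exact: theta_classes_infinite].
Qed.

Lemma eta_infiniteT : eta_infinite theta [set: nat].
Proof.
exists (classes theta); split=> //; first exact: theta_classes_infinite.
by apply/seteqP; split=> // x _; exists (theta x) => //; exists x.
Qed.

Lemma re_eta_infinite A : re A /\ eta_infinite theta A <-> A = [set: nat].
Proof.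
split=> [[reA infA]|->].
  case: (@re_dichotomy A) => //; last by move/(eta_infinite_unbounded infA).
  apply/(eta_closedP (theta_equiv w)).
  by have [F [FC _ EA]] := infA; exists F.
split; last exact: eta_infiniteT.
by apply: (@re_of_stages _ (fun _ _ => true)) => [|x]; [rec_tac | split=> // _; exists 0].
Qed.

(** * Uniformly r.e. one-one families of closed sets *)

Section Family.

Variables (B : nat -> set nat).
Hypothesis B_closed : forall i, closed (B i).
Hypothesis B_inj : injective B.
Hypothesis B_re : re2 B.

(* Take [d] least such that only finitely many members contain [0, ..., d].
   The other members containing [0, ..., d - 1] have an r.e. closed union
   missing [d], which is thus a union of finitely many classes and has only
   finitely many closed subsets. *)
Lemma family_initial_segment d m : exists2 i, m <= i & forall x, x < d -> B i x.
Proof.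
have [b [cb mb bP]] := re2_stages B_re.
elim: d m => [|d IHd] m; first by exists m.
apply: contrapT => nex; pose I := [set i | m <= i /\ forall x, x < d -> B i x].
have nId i : I i -> ~ B i d.
  move=> [mi Bi] Bd; apply: nex; exists i => // x; rewrite ltnS leq_eqVlt.
  by move=> /orP[/eqP-> //|]; exact: Bi.
pose U := \bigcup_(i in I) B i.
have cU : closed U by move=> x y xy [i Ii Bx]; exists i => //; exact: B_closed xy Bx.
have reU : re U.
  (* That [B i] contains [0, ..., d - 1] is confirmed by finitely many enumerations, so the
     restriction to [I] keeps the union r.e. *)
  apply: (@re_of_stages _ (fun s x => bex s (fun i =>
      [&& m <= i, ball d (fun z => b s i z) & b s i x]))) => [|x].
    by rec_tac; apply: (@computable_app3 _ (fun s i z => b s i z)) => //; rec_tac.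
  split=> [[i [mi Bi] /bP[s bx]]|[s /bexP[i _ /and3P[mi /ballP bi bx]]]]; last first.
    exists i; last by apply/bP; exists s.
    by split=> // z zd; apply/bP; exists s; exact: bi.
  have [t Ht] : exists t, forall z u, z < d -> t <= u -> b u i z.
    by apply: eventually_forall_lt => z /Bi/bP[t bz]; exists t => u tu; exact: mb bz.
  exists (maxn i.+1 (maxn s t)); apply/bexP; exists i; first exact: leq_maxl.
  apply/and3P; split=> //.
    by apply/ballP => z zd; apply: Ht => //; rewrite !leq_max leqnn !orbT.
  by apply: mb bx; rewrite !leq_max leqnn !orbT.
case: (re_dichotomy reU cU) => [[N HN]|UT]; last first.
  have : U d by rewrite UT.
  by move=> [i Ii]; exact: nId.
(* A member inside [U] is determined by its trace below [N], where all settled markers of [U]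
   lie. *)
pose g i := [ffun x : 'I_N => `[< B i x >]].
have /finite_nat_bounded[M HM] : finite_set I.
  apply: (@finite_image_inj _ _ _ g); last exact: finite_finset.
  move=> i j Ii Ij /ffunP Eg; apply: B_inj; have UI k : I k -> B k `<=` U.
    by move=> Ik y By; exists k.
  apply: closed_ext => [||y fy]; [exact: B_closed|exact: B_closed|split=> By].
    have yN : y < N by apply: HN fy _; exact: UI By.
    by have := Eg (Ordinal yN); rewrite !ffunE => E;
       have [H _] := asbool_eq_equiv E; exact: H By.
  have yN : y < N by apply: HN fy _; exact: UI By.
  by have := Eg (Ordinal yN); rewrite !ffunE => E;
     have [_ H] := asbool_eq_equiv E; exact: H By.
have [i] := IHd (maxn m M); rewrite geq_max => /andP[mi Mi] Bi.
by have := HM i (conj mi Bi); rewrite ltnNge Mi.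
Qed.

(** Of two members with different indices at most one is the whole set. *)
Lemma proper_member_initial_segment d :
  exists2 i, B i <> [set: nat] & forall x, x < d -> B i x.
Proof.
have [i _ Bi] := family_initial_segment d 0.
have [j ij Bj] := family_initial_segment d i.+1.
have [Ei|] := pselect (B i = [set: nat]); last by exists i.
exists j => // Ej; have := B_inj (etrans Ej (esym Ei)) => E.
by rewrite E ltnn in ij.
Qed.

Lemma member_bounded i : B i <> [set: nat] -> bounded (B i).
Proof.
move=> nT; have [b [cb mb bP]] := re2_stages B_re.
suff reB : re (B i) by case: (re_dichotomy reB (@B_closed i)).
apply: (@re_of_stages _ (fun s x => b s i x)) => [|x]; last exact: bP.
by apply: (@computable_app3 _ (fun s i z => b s i z)) => //; rec_tac.
Qed.

Lemma ascending_chain : exists c : nat -> nat,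
  [/\ forall n, B (c n) <> [set: nat],
      forall n, B (c n) `<` B (c n.+1) &
      forall n x, x < n -> B (c n) x].
Proof.
have next (p : nat * nat) : exists j, B p.1 <> [set: nat] ->
    [/\ B j <> [set: nat], B p.1 `<` B j & forall x, x < p.2 -> B j x].
  case: p => i n /=; have [Ei|Ei] := pselect (B i = [set: nat]); first by exists 0.
  have [N HN] := member_bounded Ei.
  have [z nz] : exists z, ~ B i z.
    by apply/existsNP => all; apply: Ei; apply/seteqP; split.
  (* [N] covers all settled markers of [B i], [z.+1] makes the inclusion strict, and [n] makes the
     chain exhaust all numbers. *)
  have [j Ej Bj] := proper_member_initial_segment (maxn N (maxn n z.+1)).
  exists j => _; split=> // [|x xn]; last by apply: Bj; rewrite !leq_max xn orbT.
  split=> [x Bx|]; last first.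
    by apply/existsNP; exists z => H; apply/nz/H/Bj; rewrite !leq_max leqnn !orbT.
  have [y fy xy] := final_rep w x; apply: (B_closed (theta_sym xy)); apply: Bj.
  by rewrite leq_max (HN y fy (B_closed xy Bx)).
have [f fP] := choice next; have [i0 Ei0 _] := proper_member_initial_segment 0.
pose c := fix c n := if n is k.+1 then f (c k, n) else i0.
have cT n : B (c n) <> [set: nat].
  by elim: n => //= n IHn; have [] := fP (c n, n.+1) IHn.
exists c; split=> // [n|[|n] x xn] //=; first by have [] := fP (c n, n.+1) (cT n).
by have [_ _] := fP (c n, n.+1) (cT n); apply.
Qed.

End Family.

(** * Limit guesses and vacillatory learning *)

Lemma digits_trunc B N s f g : N <= s -> (forall y, y < N -> f y = g y) ->
  (forall y, N <= y -> f y = 0) -> digits B s f = digits B N g.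
Proof.
move=> Ns fg f0; rewrite /digits /bsum -(subnKC Ns) big_split_ord /=.
rewrite [X in _ + X]big1 ?addn0; last by move=> i _; rewrite f0 ?leq_addr.
by apply: eq_bigr => i _; rewrite fg.
Qed.

(** [K] is the bit mask of the settled markers in [L]; it depends on [L] alone, so different correct
    indices lead to the same limit. *)
Lemma guess_limit L : closed L -> bounded L -> exists K,
  (forall y, odd (K %/ 2 ^ y) = `[< final y /\ L y >]) /\
  forall e, eta_closure theta (W e) = L -> exists s0, forall s, s0 <= s -> guess e s = K.
Proof.
move=> cL [N HN]; pose bit y : nat := `[< final y /\ L y >].
have bit_le y : bit y < 2 by rewrite /bit; case: asbool.
have bit0 y : N <= y -> bit y = 0.
  rewrite /bit => Ny; case: asboolP => // -[fy /(HN _ fy)].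
  by rewrite ltnNge Ny.
exists (digits 2 N bit); split=> [y|e EL].
  case: (ltnP y N) => yN.
    by apply: (can_inj oddb); rewrite -modn2 digitsE //.
  rewrite divn_small; last by apply: leq_trans (@digits_lt 2 N bit _) _; rewrite ?leq_exp2l.
  by have := bit0 y yN; rewrite /bit; case: asbool.
(* This settled marker outside [L] is never met by [e] and blocks every [y > g] of rank above
   [e]. *)
have [g Ng fg] := final_unbounded w_mono N.
have nLg : ~ L g by move=> /(HN _ fg); rewrite ltnNge Ng.
have nTg s : ~~ touches s (rep s) e g.
  by apply/negP => tg; apply: nLg; rewrite -EL; apply/touches_closure => //; exists s.
have [Ne HNe] := rank_large w_mono e.
(* From [m] on, numbers exceed [g] and have rank above [e]; below [m] only finitely many facts have
   to settle. *)
pose m := maxn g.+1 (maxn N Ne).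
have [s1 Hs1] : exists s, forall y t, y < m -> s <= t ->
    (rep t y == y) = `[< final y >] /\ (final y -> touches t (rep t) e y = `[< L y >]).
  apply: eventually_forall_lt => y _; have [fy|nfy] := pselect (final y); last first.
    have [s Hs] := not_final nfy; exists s => t /Hs/negbTE ->.
    by split=> //; rewrite asboolF.
  have [Ly|nLy] := pselect (L y).
    have /(touches_closure e fy)[s Hs] : eta_closure theta (W e) y by rewrite EL.
    exists s => t st; rewrite fy eqxx asboolT //; split=> // _.
    by rewrite asboolT //; exact: touches_mono (fy t) Hs.
  exists 0 => t _; rewrite fy eqxx asboolT //; split=> // _.
  rewrite asboolF //; apply/negP => Ht; apply: nLy; rewrite -EL.
  by apply/touches_closure => //; exists t.
have [s2 Hs2] : exists s, forall y t, y < m -> s <= t -> final y -> L y ->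
    (rank (rep t) y <= e) || ball y (fun x => (rep t x == x) ==> touches t (rep t) e x).
  apply: eventually_forall_lt => y ym.
  (* Either the rank drops to at most [e] for good, or it always exceeds [e] and all settled markers
     below [y] get met. *)
  have [[s Hs]|nle] := pselect (exists s, rank (rep s) y <= e).
    by exists s => t st _ _; rewrite (leq_trans (rank_mono w y st) Hs).
  exists s1 => t st fy Ly; apply/orP; right; apply/ballP => x xy; apply/implyP.
  have [-> Hx] := Hs1 x t (ltn_trans xy ym) st; move=> /asboolP fx; rewrite Hx //.
  apply/asboolP; rewrite -EL; apply/touches_closure => //.
  apply: (final_touches_below w_mono fx fy xy).
    by move=> s; rewrite ltnNge; apply/negP => le; apply: nle; exists s.
  by apply/touches_closure => //; rewrite EL.
exists (maxn N (maxn s1 s2)) => s; rewrite !geq_max => /and3P[Ns s1s s2s].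
have low y : y < m -> accepted s (rep s) e y = bit y :> nat.
  move=> ym; rewrite /accepted /bit; have [-> Ht] := Hs1 y s ym s1s.
  have [fy|nfy] := pselect (final y); last first.
    by rewrite asboolF // asboolF // => -[].
  rewrite asboolT // Ht //; have [Ly|nLy] := pselect (L y); last first.
    by rewrite asboolF // asboolF // => -[].
  by rewrite asboolT // asboolT // Hs2.
apply: digits_trunc => // y; first by move=> yN; apply: low; rewrite /m !leq_max yN orbT.
move=> Ny; case: (ltnP y m) => [ym|]; first by rewrite low // bit0.
rewrite !geq_max => /and3P[gy _ Ney]; rewrite /accepted.
rewrite leqNgt HNe //= (_ : ball _ _ = false) ?andbF //.
apply/negbTE/negP => /ballP/(_ g gy); rewrite fg eqxx /=; exact/negP.
Qed.

Lemma closure_finals L : closed L -> eta_closure theta [set y | final y /\ L y] = L.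
Proof.
move=> cL; apply/seteqP; split=> [x [y [_ Ly] yx]|x Lx]; first exact: cL yx Ly.
have [y fy xy] := final_rep w x; exists y; last exact: theta_sym.
by split=> //; exact: cL xy Lx.
Qed.

(** The code of the input serves as the stage of the guess; by this bound the stages tend to
    infinity along a text. *)
Lemma size_code_seq s : size s <= code_seq s.
Proof.
elim: s => //= x s IHs; rewrite /code_seq /= -/(code_seq s).
apply: leq_ltn_trans IHs _; rewrite -[ltnLHS]mul1n.
apply: leq_trans (_ : 1 * (code_seq s).*2.+1 <= _); last by rewrite leq_mul2r expn_gt0 orbT.
by rewrite !mul1n ltnS -addnn leq_addr.
Qed.

Lemma vac_ex_learnable C : (forall L, C L -> closed L /\ bounded L) ->
  vac_learnable theta W C -> ex_learnable theta W C.
Proof.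
move=> CP [M [[f fM] bcM vacM]]; have [_ _ accW] := hW.
(* Acceptability supplies a recursive [h] turning a bit mask into an index of the set it codes. *)
have reV : re2 (fun K => [set y | odd (K %/ 2 ^ y)]).
  apply: (@re2_of_stages _ (fun _ K y => odd (K %/ 2 ^ y))) => [|K y]; first by rec_tac.
  by split=> [|[]] //=; exists 0.
have [h [/recursiveP ch hP]] := accW _ reV.
exists (fun s => omap (fun e => h (guess e (code_seq s))) (M s)); split.
  pose dec n := if n is k.+1 then Some k else None.
  have decK : cancel dec code_opt by case.
  (* Every number codes a sequence, so the learner becomes a total function on numbers. *)
  pose F x := code_opt (M (map dec (CodeSeq.decode x))).
  have cF : computable 1 (fun v => F (v 0)).
    exists f => v; rewrite args1 /F; set s := map _ _.
    rewrite [v 0](_ : _ = code_seq s) ?fM //.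
    by rewrite /code_seq /s -map_comp map_id_in ?CodeSeq.decodeK // => k _; exact: decK.
  have cdec : cancel code_opt dec by case.
  have FE s : F (code_seq s) = code_opt (M s).
    rewrite /F /code_seq CodeSeq.codeK -map_comp map_id_in // => o _; exact: cdec.
  have [f' f'P] : computable 1 (fun v =>
      if F (v 0) == 0 then 0 else (h (guess (F (v 0)).-1 (v 0))).+1).
    apply: computable_if; rec_tac.
    apply: (computable_app1 ch); apply: (computable_app2 (computable_guess w_computable)); rec_tac.
  exists f' => s; have := f'P (fun=> code_seq s); rewrite args1 FE.
  by case: (M s).
move=> L T CL TL; have [cL bL] := CP L CL.
have [K [bitK limK]] := guess_limit cL bL.
exists (Some (h K)); split.
  exists (h K); split=> //; rewrite hP -[RHS](closure_finals cL).
  congr eta_closure; apply/seteqP; split=> y /=; rewrite bitK; first by move/asboolP.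
  by move=> H; apply/asboolP.
have [n1 Hn1] := bcM L T CL TL.
have [l El] := (finite_seqP _).1 (vacM L T CL TL).
(* Each output gets a threshold for its guesses, 0 if it is incorrect; only finitely many outputs
   occur on [T], so the thresholds have a maximum. *)
have lim (o : option nat) : exists s0, forall e, o = Some e ->
    eta_closure theta (W e) = L -> forall s, s0 <= s -> guess e s = K.
  case: o => [e|]; last by exists 0.
  have [EL|nEL] := pselect (eta_closure theta (W e) = L); last by exists 0 => _ [<-].
  by have [s0 Hs0] := limK e EL; exists s0 => _ [<-].
have [b bP] := choice lim.
exists (maxn 1 (maxn n1 (\max_(o <- l) b o))) => n; rewrite !geq_max => /and3P[n0 n1n bn].
have [e [EM Ee]] := Hn1 n n1n; rewrite EM /=; congr (Some (h _)).
apply: bP EM Ee _ _.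
have Ml : M (init_seg T n) \in l.
  have : [set M (init_seg T n) | n in [set n | 0 < n]] (M (init_seg T n)) by exists n.
  by rewrite El.
apply: leq_trans (_ : size (init_seg T n) <= _); last exact: size_code_seq.
rewrite size_mkseq; apply: leq_trans bn.
exact: (@leq_bigmax_seq _ l xpredT b).
Qed.

End Consequences.

Theorem theorem9 (W : nat -> set nat) (hW : acceptable_numbering W) :
  exists theta : nat -> set nat,
    [/\ positive_equivalence theta,
        forall A : set nat, (re A /\ eta_infinite theta A) <-> A = [set: nat],
        forall C : set (set nat), eta_family theta C ->
          [/\ exists B : nat -> set nat,
                [/\ forall i, C (B i),
                    forall i, eta_finite theta (B i),
                    forall i, B i `<` B i.+1
                  & \bigcup_i B i = [set: nat]],
              ~ confidently_learnable theta W C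
            & bc_learnable theta W C -> forall L, C L -> eta_finite theta L]
      & forall C : set (set nat), eta_family theta C ->
          vac_learnable theta W C -> ex_learnable theta W C].
Proof.
have [reW _ _] := hW; have [w [w_comp w_mono wP]] := re2_stages reW.
have closedP := eta_closedP (theta_equiv w).
have member C L : eta_family (theta w) C -> C L ->
    (forall x y, theta w x y -> L x -> L y) /\
    (L <> [set: nat] -> exists N, forall y, final w y -> L y -> y < N).
  move=> [_ CC [B [BC Binj Bre]]] CL.
  have B_closed i : forall x y, theta w x y -> B i x -> B i y.
    by apply/closedP/CC; rewrite -BC; exists i.
  move: CL; rewrite -BC => -[i _ <-]; split; first exact: B_closed.
  exact: (member_bounded hW w_mono wP B_closed Bre).
have chain C : eta_family (theta w) C -> exists c : nat -> set nat,
    [/\ forall n, C (c n), forall n, c n <> [set: nat],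
        forall n, c n `<` c n.+1 & forall n x, x < n -> c n x].
  move=> [_ CC [B [BC Binj Bre]]].
  have B_closed i : forall x y, theta w x y -> B i x -> B i y.
    by apply/closedP/CC; rewrite -BC; exists i.
  have [c [cT cS cn]] := ascending_chain hW w_mono wP B_closed Binj Bre.
  by exists (B \o c); split=> // n; rewrite -BC; exists (c n).
have chain_texts C c M : (forall n, C (c n)) -> (forall n x, x < n -> c n x) ->
    bc_learns (theta w) W M C -> exists T, text_for T [set: nat] /\ forall n0, exists n i,
    [/\ n0 <= n, n0 <= i & correct (theta w) W (M (init_seg T n)) (c i)].
  move=> Cc cn bcM; apply: chain_text => // L T [i _ <-]; exact: bcM.
(* On the text that follows the chain, the learner conjectures proper members infinitely often, so
   it fails on the whole set. *)
have bc_proper C L : eta_family (theta w) C -> bc_learnable (theta w) W C -> C L ->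
    L <> [set: nat].
  move=> famC [M [_ bcM]] CL EL; have [c [Cc cT _ cn]] := chain C famC.
  have [T [TT HT]] := chain_texts C c M Cc cn bcM.
  rewrite EL in CL; have [n0 Hn0] := bcM _ _ CL TT.
  have [n [i [/Hn0 coT _ co]]] := HT n0.
  exact: cT i (correct_fun co coT).
exists (theta w); split.
- exact: theta_positive w_comp w_mono.
- by move=> A; exact: (re_eta_infinite hW w_mono wP).
- move=> C famC; have [c [Cc cT cS cn]] := chain C famC; split.
  + exists c; split=> // [i|].
      have [cl bd] := member C (c i) famC (Cc i).
      exact: bounded_eta_finite cl (bd (cT i)).
    by apply/seteqP; split=> // x _; exists x.+1 => //; exact: cn.
  + move=> [M [_ exM conM]].
    have [T [TT HT]] := chain_texts C c M Cc cn (ex_bc exM).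
    have [o [n0 Hn0]] := conM _ _ TT.
    have [n [i [n0n _ co]]] := HT n0.
    have [m [j [lem lej co']]] := HT (maxn n0 i.+1).
    rewrite Hn0 // in co; rewrite Hn0 ?(leq_trans _ lem) ?leq_maxl // in co'.
    (* The limit hypothesis would equal both [c i] and [c j] with [i < j], but the chain is
       strict. *)
    have mono k l : k <= l -> c k `<=` c l.
      move=> /subnKC <-; elim: (l - k) => [|d IHd]; first by rewrite addn0.
      by rewrite addnS; apply: subset_trans IHd _; have [] := cS (k + d).
    have [_ []] := cS i; rewrite (correct_fun co co').
    by apply: mono; apply: leq_trans lej; exact: leq_maxr.
  + move=> bcC L CL; have [cl bd] := member C L famC CL.
    exact/(bounded_eta_finite cl)/bd/(bc_proper C L famC bcC CL).
- move=> C famC vac; apply: (vac_ex_learnable hW w_comp w_mono wP _ vac) => L CL.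
  have bcC : bc_learnable (theta w) W C by have [M []] := vac; exists M.
  have [cl bd] := member C L famC CL; split=> //.
  exact: bd (bc_proper C L famC bcC CL).
Qed.
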